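(* Assume the standing setting described in the context, and let $L:=\{\ell\in I: C(A_\ell)=\infty\}$, assumed nonempty and contained in $I^-$. Let $\tilde{\boldsymbol\lambda}=(\tilde\lambda^i)_{i\in I}$ be a solution of the $(\boldsymbol A,\boldsymbol a,g,\chi,I\setminus L)$-problem, and suppose that $$a_\ell\ge\int g\,d\tilde\lambda^\ell\quad\text{for all }\ell\in L.$$ Then $G_\chi(\boldsymbol A,\boldsymbol a,g)=G_\chi(\boldsymbol A,\boldsymbol a,g,I\setminus L)$, and the Gauss variational problem (the $(\boldsymbol A,\boldsymbol a,g,\chi,I)$-problem) is solvable if and only if $a_\ell=\int g\,d\tilde\lambda^\ell$ for all $\ell\in L$.
   Context: Standing setting. $\mathrm X$ is a noncompact locally compact Hausdorff space; $\mathfrak M$ is the space of real Radon measures on $\mathrm X$ with the vague topology; $S(\nu)$ is the support of $\nu$; $\nu$ is bounded if $|\nu|(\mathrm X)<\infty$. The kernel $\kappa:\mathrm X\times\mathrm X\to[0,\infty]$ is lower semicontinuous and symmetric; $\kappa(\nu,\nu_1)=\int\kappa\,d(\nu\otimes\nu_1)$, $\kappa(x,\nu)=\int\kappa(x,y)\,d\nu(y)$; $\mathcal E$ is the set of $\nu\in\mathfrak M$ with $\kappa(\nu,\nu)$ well defined and finite. Assumed: (a) $\kappa$ strictly positive definite ($\kappa(\nu,\nu)\ge0$ whenever defined and $\|\nu\|:=\kappa(\nu,\nu)^{1/2}$ is a norm on the pre-Hilbert space $\mathcal E$; ''strong'' refers to this norm); (b) consistent: every strong Cauchy net in $\mathcal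 E^+:=\{\nu\in\mathcal E:\nu\ge0\}$ converges strongly to each of its vague cluster points; (c) $\kappa(x,y)$ finite and continuous for $x\ne y$; (d) for every $\varepsilon>0$ and compact $K$ there is a compact $K'$ with $\kappa(x,y)<\varepsilon$ for $x\in K$, $y\notin K'$; (e) generalized maximum principle with constant $h\ge1$: for compactly supported $\nu\ge0$ with $M:=\sup_{S(\nu)}\kappa(\cdot,\nu)<\infty$, $\kappa(\cdot,\nu)\le hM$ on $\mathrm X$. $\mathcal E^+_E$: elements of $\mathcal E^+$ concentrated on $E$ (complement locally negligible). Interior capacity $C(E)=1/\inf\{\kappa(\nu,\nu):\nu\in\mathcal E^+_E,\nu(E)=1\}$; ''n.e.'' = except on a set of interior capacity zero. Condenser: disjoint countable index sets $I^+,I^-$ ($I^-$ possibly empty), $I=I^+\cup I^-$; nonempty closed $A_i\subset\mathrm X$, every compact set meets finitely many $A_i$, $A_i\cap A_j=\varnothing$ for $i\in I^+,j\in I^-$; $\alpha_i=\pm1$ for $i\in I^\pm$; $A^\pm=\bigcup_{i\in I^\pm}A_i$, $A=\bigcup_iA_i$; $\sup_{A^+\times A^-}\kappa<\infty$. Vector measures $\boldsymbol\mu=(\mu^i)_{i\in I}$, $\mu^i\ge0$ concentrated on $A_i$; $R\boldsymbol\mu=\sum_i\alpha_i\mu^i$; energy $\kappa(\boldsymbol\mu,\boldsymbol\mu)=\sum_{i,j}\alpha_i\alpha_j\kappa(\mu^i,\mu^j)$; $\mathcal E^+(\boldsymbol A)$ = vector measures of finite energy. External field: bounded signed $\chi\in\mathcal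 E$ with $S(\chi^+)\cap A^-=\varnothing$, $S(\chi^-)\cap A^+=\varnothing$; $G_\chi(\boldsymbol\mu):=\|R\boldsymbol\mu\|^2+2\kappa(\chi,R\boldsymbol\mu)$ $(=\kappa(\boldsymbol\mu,\boldsymbol\mu)+2\sum_i\alpha_i\int\kappa(x,\chi)d\mu^i(x))$. $g$ continuous on $A$, $g_{\inf}:=\inf_Ag>0$, and for each $i$ either $g|_{A_i}$ bounded or $g^{r_i}\le\kappa(\cdot,\nu_i)$ n.e. on $A_i$ for some $r_i>1$, $\nu_i\in\mathcal E$. $\boldsymbol a=(a_i)$, $a_i>0$, $\sum_ia_i<\infty$. For $I^+\subseteq J\subseteq I$: $\mathcal E^+(\boldsymbol A,\boldsymbol a,g,J)=\{\boldsymbol\mu\in\mathcal E^+(\boldsymbol A):\int g\,d\mu^i=a_i\ \forall i\in J\}$; $G_\chi(\boldsymbol A,\boldsymbol a,g,J)$ is the infimum of $G_\chi$ over it; the $(\boldsymbol A,\boldsymbol a,g,\chi,J)$-problem asks for a minimizer in this class. For $J=I$ the symbol $J$ is dropped and the problem is the Gauss variational problem. It is assumed that $G_\chi(\boldsymbol A,\boldsymbol a,g)<\infty$. *)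

(* Defs.v *)
From HB Require Import structures.
From mathcomp Require Import all_boot all_order all_algebra.
From mathcomp Require Import all_classical all_reals all_analysis.
Set Implicit Arguments. Unset Strict Implicit. Unset Printing Implicit Defensive.
Import Order.TTheory GRing.Theory Num.Theory.
Import numFieldNormedType.Exports.
Local Open Scope classical_set_scope.
Local Open Scope ring_scope.

Definition borelX (X : ptopologicalType) := g_sigma_algebraType (@open X).

Notation pmeas R X := {measure set (borelX X) -> \bar R}.

Section Potential.
Context {R : realType} {X : ptopologicalType}.
Local Open Scope ereal_scope.

Definition outer_meas (mu : pmeas R X) (S : set X) : \bar R :=
  ereal_inf [set mu B | B in [set B : set (borelX X) | measurable B /\ S `<=` B]].

Definition radon (mu : pmeas R X) : Prop :=
  [/\ (forall K : set X, compact K -> mu K < +oo),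
      (forall B : set (borelX X), measurable B ->
         mu B = ereal_inf [set mu U | U in [set U : set X | open U /\ B `<=` U]]) &
      (forall U : set X, open U ->
         mu U = ereal_sup [set mu K | K in [set K : set X | compact K /\ K `<=` U]])].

Definition support (mu : pmeas R X) : set X :=
  [set x | forall U : set X, open U -> U x -> 0 < mu U].

Definition concentrated (mu : pmeas R X) (E : set X) : Prop :=
  forall K : set X, compact K -> outer_meas mu (K `\` E) = 0.

(* real (signed) Radon measures, given by their Jordan decomposition (nu^+, nu^-) *)
Definition signed_radon (nu : pmeas R X * pmeas R X) : Prop :=
  [/\ radon nu.1, radon nu.2 &
      exists B : set (borelX X), [/\ measurable B, nu.1 (~` B) = 0 & nu.2 B = 0]].

Definition Cc (phi : X -> R) : Prop :=
  continuous phi /\ exists K : set X, compact K /\ forall x, ~ K x -> phi x = 0%R.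

Definition vint (mu : pmeas R X) (phi : X -> R) : \bar R := \int[mu]_x (phi x)%:E.

Variable kappa : X -> X -> \bar R.

Definition pot (nu : pmeas R X) (x : X) : \bar R := \int[nu]_y kappa x y.

(* mutual energy kappa(mu, nu) = int kappa d(mu (x) nu) of positive measures,
   computed as an iterated integral (Fubini for lsc kernels >= 0) *)
Definition mutual (mu nu : pmeas R X) : \bar R := \int[mu]_x pot nu x.

(* energy of a signed measure:  int kappa d(nu(x)nu)^+ - int kappa d(nu(x)nu)^- *)
Definition senergy_pos (nu : pmeas R X * pmeas R X) : \bar R :=
  mutual nu.1 nu.1 + mutual nu.2 nu.2.
Definition senergy_neg (nu : pmeas R X * pmeas R X) : \bar R :=
  mutual nu.1 nu.2 + mutual nu.2 nu.1.
Definition senergy_defined (nu : pmeas R X * pmeas R X) : Prop :=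
  ~ (senergy_pos nu = +oo /\ senergy_neg nu = +oo).
Definition senergy (nu : pmeas R X * pmeas R X) : \bar R :=
  senergy_pos nu - senergy_neg nu.

Definition in_E (nu : pmeas R X * pmeas R X) : Prop :=
  [/\ signed_radon nu, senergy_pos nu < +oo & senergy_neg nu < +oo].

Definition in_Eplus (mu : pmeas R X) : Prop := radon mu /\ mutual mu mu < +oo.

(* || mu - nu ||^2 for mu, nu in E^+ *)
Definition dist2 (mu nu : pmeas R X) : \bar R :=
  mutual mu mu + mutual nu nu - mutual mu nu - mutual nu mu.

Definition strictly_pd : Prop :=
  (forall nu, signed_radon nu -> senergy_defined nu -> 0 <= senergy nu) /\
  (forall nu, in_E nu -> senergy nu = 0 ->
     forall B : set (borelX X), measurable B -> nu.1 B = 0 /\ nu.2 B = 0).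

Definition directed_set (D : Type) (le : D -> D -> Prop) : Prop :=
  [/\ inhabited D, (forall d, le d d), (forall a b c, le a b -> le b c -> le a c) &
      (forall a b, exists c, le a c /\ le b c)].

Definition strong_cauchy (D : Type) (le : D -> D -> Prop) (nu : D -> pmeas R X) : Prop :=
  forall eps : R, (0 < eps)%R -> exists d0, forall d1 d2, le d0 d1 -> le d0 d2 ->
    dist2 (nu d1) (nu d2) < eps%:E.

Definition strong_conv (D : Type) (le : D -> D -> Prop) (nu : D -> pmeas R X)
    (mu : pmeas R X) : Prop :=
  mutual mu mu < +oo /\
  forall eps : R, (0 < eps)%R -> exists d0, forall d, le d0 d -> dist2 (nu d) mu < eps%:E.

Definition vague_cluster (D : Type) (le : D -> D -> Prop) (nu : D -> pmeas R X)
    (mu : pmeas R X) : Prop :=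
  forall (n : nat) (phi : 'I_n -> X -> R) (eps : R), (forall k, Cc (phi k)) -> (0 < eps)%R ->
  forall d0, exists d, le d0 d /\ forall k, `| vint (nu d) (phi k) - vint mu (phi k) | < eps%:E.

Definition consistent : Prop :=
  forall (D : Type) (le : D -> D -> Prop) (nu : D -> pmeas R X),
    directed_set le -> (forall d, in_Eplus (nu d)) -> strong_cauchy le nu ->
    forall mu, radon mu -> vague_cluster le nu mu -> strong_conv le nu mu.

Definition offdiag_continuous : Prop :=
  forall x y : X, x <> y ->
    kappa x y < +oo /\ {for (x, y), continuous (fun p : X * X => kappa p.1 p.2)}.

Definition kernel_decay : Prop :=
  forall (eps : R) (K : set X), (0 < eps)%R -> compact K ->
    exists K' : set X, compact K' /\ forall x y, K x -> ~ K' y -> kappa x y < eps%:E.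

(* (e) generalized maximum principle with constant h (nonzero nu; for nu = 0 it is void) *)
Definition gen_max_principle (h : R) : Prop :=
  forall nu : pmeas R X, radon nu -> compact (support nu) -> support nu !=set0 ->
    ereal_sup (pot nu @` support nu) < +oo ->
    forall x, pot nu x <= h%:E * ereal_sup (pot nu @` support nu).

Definition Eplus_on (E : set X) (nu : pmeas R X) : Prop := in_Eplus nu /\ concentrated nu E.

Definition inner_cap (E : set X) : \bar R :=
  let m := ereal_inf [set mutual nu nu | nu in
                      [set nu | Eplus_on E nu /\ outer_meas nu E = 1]] in
  if m == 0 then +oo else if m == +oo then 0 else ((fine m)^-1)%:E.

Definition nearly_everywhere (E : set X) (P : X -> Prop) : Prop :=
  inner_cap [set x | E x /\ ~ P x] = 0.

Context {I : countType}.
Variables (Ip : I -> bool) (A : I -> set X).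
(* Ip i  <->  i in I^+ ;  ~~ Ip i  <->  i in I^- *)

Definition Aplus : set X := [set x | exists2 i, Ip i & A i x].
Definition Aminus : set X := [set x | exists2 i, ~~ Ip i & A i x].
Definition Aall : set X := [set x | exists i, A i x].

Definition condenser : Prop :=
  [/\ (forall i, closed (A i) /\ A i !=set0),
      (forall K : set X, compact K -> finite_set [set i | A i `&` K !=set0]),
      (forall i j, Ip i -> ~~ Ip j -> A i `&` A j = set0) &
      (exists M : R, forall x y, Aplus x -> Aminus y -> kappa x y <= M%:E)].

Definition external_field (chi : pmeas R X * pmeas R X) : Prop :=
  [/\ in_E chi, chi.1 setT < +oo, chi.2 setT < +oo,
      support chi.1 `&` Aminus = set0 & support chi.2 `&` Aplus = set0].

Definition vecmeas (mu : I -> pmeas R X) : Prop :=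
  forall i, radon (mu i) /\ concentrated (mu i) (A i).

(* energy sum_{i,j} alpha_i alpha_j kappa(mu^i,mu^j), split into the terms with
   alpha_i alpha_j = +1 and = -1 *)
Definition venergy_pos (mu : I -> pmeas R X) : \bar R :=
  \esum_(p in [set p : I * I | Ip p.1 = Ip p.2]) mutual (mu p.1) (mu p.2).
Definition venergy_neg (mu : I -> pmeas R X) : \bar R :=
  \esum_(p in [set p : I * I | Ip p.1 <> Ip p.2]) mutual (mu p.1) (mu p.2).
Definition venergy (mu : I -> pmeas R X) : \bar R := venergy_pos mu - venergy_neg mu.

Definition in_EA (mu : I -> pmeas R X) : Prop :=
  [/\ vecmeas mu, venergy_pos mu < +oo & venergy_neg mu < +oo].

(* sum_i alpha_i int kappa(x, chi) d mu^i(x), split into positive and negative parts *)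
Definition field_pos (chi : pmeas R X * pmeas R X) (mu : I -> pmeas R X) : \bar R :=
  \esum_(i in [set: I])
    (if Ip i then \int[mu i]_x pot chi.1 x else \int[mu i]_x pot chi.2 x).
Definition field_neg (chi : pmeas R X * pmeas R X) (mu : I -> pmeas R X) : \bar R :=
  \esum_(i in [set: I])
    (if Ip i then \int[mu i]_x pot chi.2 x else \int[mu i]_x pot chi.1 x).

Definition Gchi (chi : pmeas R X * pmeas R X) (mu : I -> pmeas R X) : \bar R :=
  venergy mu + 2%:E * (field_pos chi mu - field_neg chi mu).

Definition g_admissible (g : X -> R) : Prop :=
  [/\ {within Aall, continuous g},
      (exists c : R, (0 < c)%R /\ forall x, Aall x -> (c <= g x)%R) &
      (forall i, (exists M : R, forall x, A i x -> (`|g x| <= M)%R) \/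
         exists (r : R) (nu : pmeas R X * pmeas R X), [/\ (1 < r)%R, in_E nu &
           nearly_everywhere (A i)
             (fun x => ((g x `^ r)%R)%:E + pot nu.2 x <= pot nu.1 x)])].

Definition adm_class (a : I -> R) (g : X -> R) (J : set I) (mu : I -> pmeas R X) : Prop :=
  in_EA mu /\ forall i, J i -> \int[mu i]_(x in A i) (g x)%:E = (a i)%:E.

Definition Ginf (chi : pmeas R X * pmeas R X) (a : I -> R) (g : X -> R) (J : set I) : \bar R :=
  ereal_inf [set Gchi chi mu | mu in adm_class a g J].

Definition solves (chi : pmeas R X * pmeas R X) (a : I -> R) (g : X -> R) (J : set I)
    (lam : I -> pmeas R X) : Prop :=
  adm_class a g J lam /\ Gchi chi lam = Ginf chi a g J.

End Potential.

(* Main.v *)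
Require Import Defs.
From HB Require Import structures.
From mathcomp Require Import all_boot all_order all_algebra.
From mathcomp Require Import all_classical all_reals all_analysis.
From mathcomp Require Import measurable_realfun.
From mathcomp Require Import ring lra.
Set Implicit Arguments. Unset Strict Implicit. Unset Printing Implicit Defensive.
Import Order.TTheory GRing.Theory Num.Theory.
Import numFieldNormedType.Exports.
Local Open Scope classical_set_scope.
Local Open Scope ring_scope.

(* The constraint bounds every total mass by (sum_i a_i) / inf g, so only
   finite Radon measures matter.  On those of finite energy, positive
   definiteness, applied to the Jordan decomposition of mu - nu, gives
   kappa(mu,nu) + kappa(nu,mu) <= kappa(mu,mu) + kappa(nu,nu), with equality
   only if mu = nu.  In terms of the two sums of the mu^i over I^+ and I^-, the Gauss
   functional is a quadratic form plus a linear one.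

   Equality of the infima: since C(A_l) = oo, A_l carries measures of unit mass
   and arbitrarily small energy; cut down to a compact set (where g is bounded)
   and rescaled, they make up for the missing a_l - int g dlam^l, with geometric
   weights in l so that their sum still has small energy.

   Solvability: a solution lam' of the full problem also minimizes the relaxed
   problem, so by the parallelogram identity at the midpoint
   R lam = R lam'.  Hence the sums over I^- agree on A^-, and integrating g
   gives sum_{I^-} int g dlam^i = sum_{I^-} a_i, where each term on the left is
   at most the corresponding one on the right. *)

(** * Finite Radon measures *)

Section FiniteRadon.
Context {R : realType} {X : ptopologicalType}.
Local Open Scope ereal_scope.
Implicit Types mu nu rho : pmeas R X.

Lemma open_borel (U : set X) : open U -> measurable (U : set (borelX X)).
Proof. by move=> oU; exact: sub_sigma_algebra. Qed.

Lemma closed_borel (C : set X) : closed C -> measurable (C : set (borelX X)).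
Proof.
move=> cC; rewrite -[C]setCK; apply: measurableC; apply: open_borel.
exact: closed_openC.
Qed.

Lemma compact_borel (K : set X) :
  hausdorff_space X -> compact K -> measurable (K : set (borelX X)).
Proof. by move=> hX cK; apply: closed_borel; exact: compact_closed. Qed.

Lemma maddE mu nu (B : set (borelX X)) :
  (measure_add mu nu : pmeas R X) B = mu B + nu B.
Proof. exact: measure_addE. Qed.

(** Tightness and outer regularity in one condition. Both clauses bound the mass of an error set
    from above, so they pass to smaller measures, to sums and to limits; the identities in [radon]
    do not transfer as directly. *)
Definition regular_approx mu := forall (B : set (borelX X)) (e : R),
  measurable B -> (0 < e)%R -> exists (K U : set X),
  [/\ compact K, open U, B `<=` U, mu (~` K) <= e%:E & mu (U `\` B) <= e%:E].

Definition finite_radon mu := radon mu /\ mu setT < +oo.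

Lemma finite_measure_fin_num mu (B : set (borelX X)) :
  mu setT < +oo -> measurable B -> mu B \is a fin_num.
Proof.
move=> fmu mB; rewrite ge0_fin_numE//; apply: le_lt_trans fmu.
by apply: le_measure; rewrite ?inE.
Qed.

(** Inner regularity of the whole space yields K, and outer regularity of B yields U. Conversely,
    inner regularity of an open set comes from outer regularity of its complement together with
    tightness. *)
Lemma finite_radonP mu : hausdorff_space X -> mu setT < +oo ->
  radon mu <-> regular_approx mu.
Proof.
move=> hX fmu; split=> [[_ outer inner] B e mB e0|reg].
  have fT := finite_measure_fin_num fmu measurableT.
  have fB := finite_measure_fin_num fmu mB.
  have [_ [K [cK _] <-] Ke] : exists2 y, [set mu K | K in [set K : set X |
      compact K /\ K `<=` setT]] y & mu setT - e%:E < y.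
    have := inner setT openT; set s := ereal_sup _ => sE.
    have : mu setT - e%:E < s by rewrite -sE lteBlDr// lteDl.
    by move/ereal_sup_gt => [y yK yl]; exists y.
  have [_ [U [oU BU] <-] Ue] : exists2 y, [set mu U | U in [set U : set X |
      open U /\ B `<=` U]] y & y < mu B + e%:E.
    have := outer B mB; set s := ereal_inf _ => sE.
    have : s < mu B + e%:E by rewrite -sE lteDl.
    by move/ereal_inf_lt => [y yK yl]; exists y.
  exists K, U; split => //.
  - have mK := compact_borel hX cK.
    rewrite -setTD measureD//.
    rewrite setTI leeBlDr ?finite_measure_fin_num//.
    by rewrite -leeBlDl//; exact: ltW.
  - have mU := open_borel oU.
    rewrite measureD//; last by rewrite -ge0_fin_numE ?finite_measure_fin_num.
    have -> : U `&` B = B by apply/setIidPr.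
    by rewrite leeBlDl//; apply: ltW.
split.
- move=> K cK; apply: le_lt_trans fmu.
  by apply: le_measure; rewrite ?inE//; exact: compact_borel.
- move=> B mB; apply/eqP; rewrite eq_le; apply/andP; split.
    apply: le_ereal_inf_tmp => _ [U [oU BU] <-].
    by apply: le_measure; rewrite ?inE//; exact: open_borel.
  apply/lee_addgt0Pr => e e0.
  have [K [U [_ oU BU _ Ue]]] := reg B e mB e0.
  apply: (@le_trans _ _ (mu U)); first by apply: ereal_inf_lbound; exists U.
  have -> : U = B `|` (U `\` B) by rewrite setDUK.
  have mU := open_borel oU.
  apply: (le_trans (measureU2 mu mB _)); first exact: measurableD.
  by rewrite leeD2l.
- move=> U oU; apply/eqP; rewrite eq_le; apply/andP; split; last first.
    apply: ge_ereal_sup => _ [K [cK KU] <-].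
    apply: le_measure; rewrite ?inE//; first exact: compact_borel.
    exact: open_borel.
  have mU := open_borel oU.
  apply/lee_addgt0Pr => e e0.
  have e20 : (0 < e / 2)%R by rewrite divr_gt0.
  (* V is an open neighbourhood of the complement of U, so K minus V is a compact subset of U. What
     it misses of U lies outside K or in the part of V inside U, each of mass at most e/2. *)
  have [K [V [cK oV UV Ke Ve]]] := reg (~` U) (e / 2)%R (measurableC mU) e20.
  have cVK : compact (K `&` ~` V).
    by apply: compact_closedI => //; exact: open_closedC.
  have mK := compact_borel hX cK.
  have mV := open_borel oV.
  apply: (@le_trans _ _ (mu (K `&` ~` V) + (mu (~` K) + mu (V `\` ~` U)))).
    have m1 : measurable (K `&` ~` V : set (borelX X)).
      by apply: measurableI => //; exact: measurableC.
    have m2 : measurable (V `\` ~` U : set (borelX X)).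
      by apply: measurableD => //; exact: measurableC.
    have m3 : measurable (~` K `|` (V `\` ~` U) : set (borelX X)).
      by apply: measurableU => //; exact: measurableC.
    have m4 := measurableU _ _ m1 m3.
    apply: (@le_trans _ _ (mu ((K `&` ~` V) `|` (~` K `|` (V `\` ~` U))))).
      apply: le_measure; rewrite ?inE// => x Ux.
      have [Kx|] := pselect (K x); last by right; left.
      by have [Vx|nVx] := pselect (V x); [right; right; split|left].
    apply: (le_trans (measureU2 mu m1 m3)); rewrite leeD2l//.
    by apply: measureU2 => //; exact: measurableC.
  apply: leeD.
    apply: ereal_sup_ubound; exists (K `&` ~` V) => //; split => //.
    by move=> x [_ nV]; apply: contrapT => /UV.
  by rewrite [e]splitr EFinD; apply: leeD.
Qed.

(** The error sets of rho at level e/2 serve mu at level e. With rho a dominating measure this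
    handles domination; with rho a partial sum it handles series. *)
Lemma regular_approx_le mu :
  (forall e : R, (0 < e)%R -> exists2 rho, regular_approx rho &
     forall B : set (borelX X), measurable B -> mu B <= rho B + e%:E) ->
  hausdorff_space X -> regular_approx mu.
Proof.
move=> H hX B e mB e0.
have e20 : (0 < e / 2)%R by rewrite divr_gt0.
have [rho reg le] := H _ e20.
have [K [U [cK oU BU Ke Ue]]] := reg B _ mB e20.
have mK := compact_borel hX cK.
have mU := open_borel oU.
exists K, U; split => //.
  apply: (le_trans (le _ (measurableC mK))).
  by rewrite [leRHS](_ : _ = (e/2)%:E + (e/2)%:E) ?leeD2r// -EFinD -splitr.
apply: (le_trans (le _ (measurableD mU mB))).
by rewrite [leRHS](_ : _ = (e/2)%:E + (e/2)%:E) ?leeD2r// -EFinD -splitr.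
Qed.

Lemma regular_approx_add mu nu : hausdorff_space X ->
  regular_approx mu -> regular_approx nu ->
  regular_approx (measure_add mu nu).
Proof.
move=> hX rmu rnu B e mB e0.
have e20 : (0 < e / 2)%R by rewrite divr_gt0.
have [K [U [cK oU BU Ke Ue]]] := rmu B _ mB e20.
have [K' [U' [cK' oU' BU' Ke' Ue']]] := rnu B _ mB e20.
have mK := compact_borel hX cK.
have mU := open_borel oU.
have mK' := compact_borel hX cK'.
have mU' := open_borel oU'.
have ee : e%:E = (e/2)%:E + (e/2)%:E by rewrite -EFinD -splitr.
exists (K `|` K'), (U `&` U'); split => //.
- exact: compactU.
- exact: openI.
- by move=> x Bx; split; [exact: BU|exact: BU'].
- rewrite maddE ee; apply: leeD.
    apply: le_trans Ke; apply: le_measure; rewrite ?inE.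
    + by apply: measurableC; exact: measurableU.
    + exact: measurableC.
    + by apply: subsetC => x; left.
  apply: le_trans Ke'; apply: le_measure; rewrite ?inE.
  + by apply: measurableC; exact: measurableU.
  + exact: measurableC.
  + by apply: subsetC => x; right.
- rewrite maddE ee; apply: leeD.
    apply: le_trans Ue; apply: le_measure; rewrite ?inE.
    + by apply: measurableD => //; exact: measurableI.
    + exact: measurableD.
    + by move=> x [[]].
  apply: le_trans Ue'; apply: le_measure; rewrite ?inE.
  + by apply: measurableD => //; exact: measurableI.
  + exact: measurableD.
  + by move=> x [[]].
Qed.

Lemma finite_radon_le mu nu : hausdorff_space X -> finite_radon nu ->
  (forall B : set (borelX X), measurable B -> mu B <= nu B) ->
  finite_radon mu.
Proof.
move=> hX [rnu fnu] le.
have fmu : mu setT < +oo by apply: le_lt_trans fnu; exact: le.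
split => //; apply/finite_radonP => //; apply: regular_approx_le => // e e0.
exists nu; first exact/finite_radonP.
by move=> B mB; apply: (le_trans (le B mB)); rewrite leeDl// lee_fin ltW.
Qed.

Lemma finite_radon_add mu nu : hausdorff_space X ->
  finite_radon mu -> finite_radon nu -> finite_radon (measure_add mu nu).
Proof.
move=> hX [rmu fmu] [rnu fnu].
have f : measure_add mu nu setT < +oo by rewrite measure_addE lte_add_pinfty.
split => //; apply/finite_radonP => //.
by apply: regular_approx_add => //; apply/finite_radonP.
Qed.

Lemma finite_radon_mscale (k : {nonneg R}) mu : hausdorff_space X ->
  finite_radon mu -> finite_radon (mscale k mu).
Proof.
move=> hX [rmu fmu].
have f : mscale k mu setT < +oo.
  by rewrite /mscale lte_mul_pinfty.
split => //; apply/finite_radonP => // B e mB e0.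
(* Dividing by k + 1 instead of k also covers k = 0. *)
have k1 : (0 < k%:num + 1)%R by rewrite ltr_wpDl.
have ek0 : (0 < e / (k%:num + 1))%R by rewrite divr_gt0.
have /finite_radonP/(_ _ _ mB ek0) := rmu.
case=> // K [U [cK oU BU Ke Ue]].
have H x : x <= (e / (k%:num + 1))%:E -> k%:num%:E * x <= e%:E.
  move=> xe; apply: (@le_trans _ _ (k%:num%:E * (e / (k%:num + 1))%:E)).
    by rewrite lee_wpmul2l.
  rewrite -EFinM lee_fin mulrCA ler_piMr ?(ltW e0)//.
  by rewrite ler_pdivrMr// mul1r lerDl.
by exists K, U; split => //; rewrite /mscale H.
Qed.

Lemma finite_radon_mzero : hausdorff_space X ->
  finite_radon (mzero : pmeas R X).
Proof.
move=> hX; have f : (mzero : pmeas R X) setT < +oo by rewrite /= /mzero ltry.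
split => //; apply/finite_radonP => // B e mB e0.
exists set0, setT; split => //; rewrite ?lee_fin ?ltW//.
- exact: compact0.
- exact: openT.
Qed.

(** A partial sum is regular, and the remaining tail has total mass at most e, hence mass at most e
    on every set. *)
Lemma finite_radon_mseries (mu_ : nat -> pmeas R X) : hausdorff_space X ->
  (forall n, finite_radon (mu_ n)) -> mseries mu_ 0 setT < +oo ->
  finite_radon (mseries mu_ 0).
Proof.
move=> hX rmu f; split => //; apply/finite_radonP => //.
apply: regular_approx_le => // e e0.
have mrho n : regular_approx (msum mu_ n).
  elim: n => [|n IH].
    have [r0 f0] := finite_radon_mzero hX.
    have /finite_radonP/(_ f0) := hX; case=> + _ => /(_ r0) h B e' mB e'0.
    have [K [U [cK oU BU Ke Ue]]] := h B e' mB e'0.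
    by exists K, U; split; rewrite //= /msum big_ord0 lee_fin ltW.
  have [r fr] := rmu n.
  have /(_ IH) := @regular_approx_add (msum mu_ n) (mu_ n) hX.
  have /finite_radonP/(_ fr) := hX; case=> + _ => /(_ r) h /(_ h).
  move=> H B e' mB e'0.
  have [K [U [cK oU BU Ke Ue]]] := H B e' mB e'0.
  exists K, U; split => //.
    by apply: le_trans Ke; rewrite maddE /= /msum big_ord_recr.
  by apply: le_trans Ue; rewrite maddE /= /msum big_ord_recr.
have /fine_cvgP[/= fin /cvgr0Pnorm_lt/(_ e e0)] :=
  nneseries_tail_cvg f (fun k _ => measure_ge0 (mu_ k) setT).
move=> tail; near \oo => n.
exists (msum mu_ n); first exact: mrho.
move=> B mB; rewrite /= /mseries /msum (nneseries_split 0 n)// add0n big_mkord.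
rewrite leeD2l//; apply: (@le_trans _ _ (\sum_(n <= k <oo) mu_ k setT)).
  by apply: lee_nneseries => // k _; apply: le_measure; rewrite ?inE.
have fn : \sum_(n <= k <oo) mu_ k setT \is a fin_num by near: n.
rewrite -(fineK fn) lee_fin; apply: ltW; apply: le_lt_trans (ler_norm _) _.
by near: n.
Unshelve. all: by end_near. Qed.

End FiniteRadon.

(** * Measurability of potentials *)

Section Staircase.
Context {R : realType}.
Local Open Scope ereal_scope.

(* (1/m) #{1 <= k <= N : k/m < t}: a sum over superlevel sets only, which are
   open for an lsc function. *)
Definition stair (N m : nat) (t : \bar R) : \bar R :=
  \sum_(k < N) (m%:R^-1)%:E * (((k.+1%:R / m%:R)%:E < t)%E%:R)%:E.

Lemma stairS N m t : stair N.+1 m t =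
  stair N m t + (m%:R^-1)%:E * (((N.+1%:R / m%:R)%:E < t)%E%:R)%:E.
Proof. by rewrite /stair big_ord_recr. Qed.

Lemma stair_ge0 N m t : 0 <= stair N m t.
Proof. by apply: sume_ge0 => k _; rewrite -EFinM lee_fin mulr_ge0// invr_ge0. Qed.

Lemma stair_le N m t : 0 <= t ->
  stair N m t <= (N%:R / m%:R)%:E /\ stair N m t <= t.
Proof.
move=> t0; elim: N => [|N [IH1 IH2]].
  by rewrite /stair big_ord0 mul0r.
rewrite stairS; case: ltP => [lt|le].
  rewrite mulr1n mule1.
  have H : stair N m t + m%:R^-1%:E <= (N.+1%:R / m%:R)%:E.
    by rewrite -natr1 mulrDl mul1r EFinD leeD2r.
  by split => //; exact: le_trans H (ltW lt).
rewrite mulr0n mule0 adde0; split => //; apply: (le_trans IH1).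
by rewrite lee_fin ler_wpM2r ?invr_ge0// ler_nat.
Qed.

Lemma stair_ge N m t : (0 < m)%N ->
  (N%:R / m%:R)%:E <= stair N m t \/ t <= stair N m t + (m%:R^-1)%:E.
Proof.
move=> m0; elim: N => [|N IH].
  by left; rewrite /stair big_ord0 mul0r.
rewrite stairS; case: ltP => [lt|le].
  rewrite mulr1n mule1; left.
  case: IH => [h|h]; first by rewrite -natr1 mulrDl mul1r EFinD leeD2r.
  exact: le_trans (ltW lt) h.
rewrite mulr0n mule0 adde0; right.
case: IH => // h; apply: (le_trans le).
by rewrite -natr1 mulrDl mul1r EFinD leeD2r.
Qed.

(** With m = n + 1 and N = m^2 the cap N/m = m tends to infinity, which reaches t = +oo, while the
    step 1/m tends to 0. *)
Lemma stair_cvg (t : \bar R) : 0 <= t ->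
  (fun n => stair (n.+1 * n.+1) n.+1 t) @ \oo --> t.
Proof.
move=> t0.
have E n : ((n.+1 * n.+1)%:R / n.+1%:R = n.+1%:R :> R)%R.
  by rewrite natrM mulfK// pnatr_eq0.
have lo n : n.+1%:R%:E <= stair (n.+1 * n.+1) n.+1 t \/
    t <= stair (n.+1 * n.+1) n.+1 t + (n.+1%:R^-1)%:E.
  by rewrite -{1}(E n); exact: stair_ge.
case: t t0 lo => [r| |//] r0 lo.
- apply: (@squeeze_cvge _ _ _ _ (fun n => (r - n.+1%:R^-1)%:E) _ (fun=> r%:E)).
  + near=> n; apply/andP; split; last exact: (stair_le _ _ r0).2.
    have [h|h] := lo n; last by rewrite EFinB leeBlDr.
    apply: le_trans h; rewrite lee_fin; apply: (@le_trans _ _ r).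
      by rewrite gerBl.
    near: n; exists (Num.truncn r).+1 => // n /= rn.
    apply/ltW; apply: (lt_le_trans (truncnS_gt _)).
    by rewrite ler_nat (leq_trans rn).
  + apply: cvg_EFin; first by near=> n.
    rewrite -[X in _ --> X]subr0; apply: cvgB; first exact: cvg_cst.
    exact: cvg_harmonic.
  + exact: cvg_cst.
- apply/cvgeyPge => A; near=> n.
  have [h|h] := lo n.
    apply: le_trans h; rewrite lee_fin.
    near: n; exists (Num.truncn A).+1 => // n /= rn.
    apply/ltW; apply: (lt_le_trans (truncnS_gt _)).
    by rewrite ler_nat (leq_trans rn).
  move: h; rewrite leye_eq => /eqP h.
  have : stair (n.+1 * n.+1) n.+1 +oo < +oo.
    by apply: le_lt_trans (stair_le _ _ _).1 _ => //; rewrite ltry.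
  move=> h'; exfalso; move: h h'.
  by case: (stair _ _ _).
Unshelve. all: by end_near. Qed.

End Staircase.

Notation borel_fun X f :=
  (measurable_fun (setT : set (borelX X)) (f : borelX X -> \bar _)).

Section Potentials.
Context {R : realType} {X : ptopologicalType}.
Local Open Scope ereal_scope.
Implicit Types mu nu rho : pmeas R X.

Lemma measurable_superlevel (f : X -> \bar R) :
  (forall a : R, measurable ([set x | a%:E < f x] : set (borelX X))) ->
  borel_fun X f.
Proof.
move=> H; apply: (measurability _ (ErealGenOInfty.measurableE R)).
move=> /= _ [_ [a ->]] <-; apply: measurableI => //.
by rewrite preimage_itvoy.
Qed.

Lemma open_of_nbhs (A : set X) : (forall x, A x -> nbhs x A) -> open A.
Proof. by rewrite openE. Qed.

(* By the tube lemma, a compact subset of the section at x lies in the sections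
   at all nearby points. *)
Lemma open_section_measure_lsc nu (W : set (X * X)) (a : R) :
  radon nu -> open W ->
  open [set x | a%:E < nu [set y | W (x, y)]].
Proof.
move=> [_ _ inner] oW.
have oS x : open [set y | W (x, y)].
  rewrite openE => y /= Wxy; have /= := open_nbhs_nbhs (conj oW Wxy).
  case=> -[U V] /= [Ux Vy] UV; apply: filterS Vy => z Vz.
  by apply: UV; split => //=; exact: nbhs_singleton.
apply: open_of_nbhs => x /= ax.
have := inner _ (oS x); set s := ereal_sup _ => sE.
move: ax; rewrite sE => /ereal_sup_gt[_ [K [cK KW] <-] aK].
have /compact_near_coveringP/(_ X (nbhs x) (fun x' y => W (x', y))) := cK.
move=> /(_ _ _) near; have : \near x, K `<=` (fun y => W (x, y)).
  apply: near => y Ky; have := open_nbhs_nbhs (conj oW (KW y Ky)).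
  case=> -[U V] /= [Ux Vy] UV; exists (V, U) => // -[y' x'] /= [Vy' Ux'].
  exact: UV.
apply: filterS => x' KW'; apply: (lt_le_trans aK).
rewrite (inner _ (oS x')); apply: ereal_sup_ubound; exists K => //.
Qed.

Context (kappa : X -> X -> \bar R).
Context (kappa_ge0 : forall x y, 0 <= kappa x y).
Context (kappa_lsc : lower_semicontinuous (fun p : X * X => kappa p.1 p.2)).

Lemma measurable_kernel x :
  borel_fun X (kappa x).
Proof.
apply: measurable_superlevel => a; apply: open_borel.
have /lower_semicontinuousP/(_ a) oW := kappa_lsc.
apply: open_of_nbhs => y /= Wxy.
have /= := open_nbhs_nbhs (conj oW (Wxy : [set p | a%:E < kappa p.1 p.2] (x, y))).
case=> -[U V] /= [Ux Vy] UV; apply: filterS Vy => z Vz.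
by apply: (UV (x, z)); split => //=; exact: nbhs_singleton.
Qed.

Lemma pot_ge0 nu x : 0 <= pot kappa nu x.
Proof. by apply: integral_ge0. Qed.

(** Since nu need not be sigma-finite, Tonelli is not at hand. Instead, the kernel is replaced by
    its staircases: their integrals are finite combinations of nu-masses of open sections, which are
    lower semicontinuous in x. *)
Lemma measurable_pot nu : radon nu ->
  borel_fun X (pot kappa nu).
Proof.
move=> rnu.
pose f n x (y : borelX X) := stair (n.+1 * n.+1) n.+1 (kappa x y).
pose w (k n : nat) x : set (borelX X) := [set y | (k.+1%:R / n.+1%:R)%:E < kappa x y].
have mw k n x : measurable (w k n x).
  have := measurable_kernel x => /(_ measurableT `](k.+1%:R / n.+1%:R)%:E, +oo[%classic).
  by rewrite setTI preimage_itvoy; apply; exact: emeasurable_itv.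
have fE n x y : f n x y = \sum_(k < n.+1 * n.+1) (n.+1%:R^-1)%:E * (\1_(w k n x) y)%:E.
  rewrite /f /stair; apply: eq_bigr => k _; rewrite indicE.
  by rewrite /w mem_setE.
have mf n x : measurable_fun setT (f n x).
  rewrite (_ : f n x = fun y => \sum_(k < n.+1 * n.+1) (n.+1%:R^-1)%:E * (\1_(w k n x) y)%:E).
    apply: emeasurable_sum => k; apply: measurable_funeM.
    apply/measurable_EFinP; exact: measurable_indic.
  by apply/funext => y; exact: fE.
have If n x : \int[nu]_y f n x y = \sum_(k < n.+1 * n.+1) (n.+1%:R^-1)%:E * nu (w k n x).
  under eq_integral do rewrite fE.
  rewrite ge0_integral_sum//; last first.
    move=> k; apply: measurable_funeM.
    apply/measurable_EFinP; exact: measurable_indic.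
  apply: eq_bigr => k _; rewrite ge0_integralZl//.
  - by rewrite integral_indic// setIT.
  - apply/measurable_EFinP; exact: measurable_indic.
have mI n : borel_fun X (fun x => \int[nu]_y f n x y).
  rewrite (_ : (fun x => _) = fun x => \sum_(k < n.+1 * n.+1) (n.+1%:R^-1)%:E * nu (w k n x)).
    apply: emeasurable_sum => k; apply: measurable_funeM.
    apply: measurable_superlevel => a; apply: open_borel.
    apply: (@open_section_measure_lsc nu [set p | (k.+1%:R / n.+1%:R)%:E < kappa p.1 p.2]) => //.
    by have /lower_semicontinuousP := kappa_lsc.
  by apply/funext => x; exact: If.
rewrite (_ : pot kappa nu = fun x => limn_esup (fun n => \int[nu]_y f n x y)).
  exact: measurable_fun_limn_esup.
(* The staircases are not monotone in n, so monotone convergence does not apply. Fatou gives one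
   inequality, and the bound of each staircase by [kappa] gives the other. *)
apply/funext => x; apply/eqP; rewrite eq_le; apply/andP; split.
  apply: le_trans (limn_einf_sup _).
  have := @fatou _ _ R nu setT measurableT (fun n => f n x) (fun n => mf n x).
  move=> /(_ (fun n y _ => stair_ge0 _ _ _)).
  apply: le_trans; rewrite le_eqVlt; apply/orP; left; apply/eqP.
  apply: eq_integral => y _; apply/esym.
  exact: (cvg_limn_einf_sup (stair_cvg (kappa_ge0 x y))).1.
rewrite limn_esup_lim; apply: lime_le; first exact: is_cvg_esups.
apply: nearW => n; apply: ge_ereal_sup => _ [m _ <-].
apply: ge0_le_integral => //.
- by move=> y _; exact: stair_ge0.
- exact: measurable_kernel.
- by move=> y _; exact: (stair_le _ _ (kappa_ge0 x y)).2.
Qed.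

End Potentials.

(** * Mutual energy *)

Section MutualEnergy.
Context {R : realType} {X : ptopologicalType}.
Local Open Scope ereal_scope.
Context (kappa : X -> X -> \bar R).
Context (kappa_ge0 : forall x y, 0 <= kappa x y).
Context (kappa_lsc : lower_semicontinuous (fun p : X * X => kappa p.1 p.2)).
Implicit Types mu nu rho : pmeas R X.

Local Notation pot := (pot kappa).
Local Notation mutual := (mutual kappa).

Lemma mutual_ge0 mu nu : 0 <= mutual mu nu.
Proof. by apply: integral_ge0 => x _; exact: pot_ge0. Qed.

Lemma pot_add mu nu x : pot (measure_add mu nu) x = pot mu x + pot nu x.
Proof.
apply: ge0_integral_measure_add => //; exact: measurable_kernel.
Qed.

Lemma mutual_addl mu nu rho : radon rho ->
  mutual (measure_add mu nu) rho = mutual mu rho + mutual nu rho.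
Proof.
move=> rrho; apply: ge0_integral_measure_add => //.
  by move=> x _; exact: pot_ge0.
exact: measurable_pot.
Qed.

Lemma mutual_addr rho mu nu : radon mu -> radon nu ->
  mutual rho (measure_add mu nu) = mutual rho mu + mutual rho nu.
Proof.
move=> rmu rnu; rewrite /Defs.mutual.
under eq_integral do rewrite pot_add.
apply: ge0_integralD => //; try exact: measurable_pot.
- by move=> x _; exact: pot_ge0.
- by move=> x _; exact: pot_ge0.
Qed.

Lemma mutual_scalel (k : {nonneg R}) mu rho : radon rho ->
  mutual (mscale k mu) rho = k%:num%:E * mutual mu rho.
Proof.
move=> rrho; apply: ge0_integral_mscale => //; first exact: measurable_pot.
by move=> x _; exact: pot_ge0.
Qed.

Lemma mutual_scaler (k : {nonneg R}) mu rho : radon rho ->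
  mutual mu (mscale k rho) = k%:num%:E * mutual mu rho.
Proof.
move=> rrho; rewrite /Defs.mutual.
rewrite (eq_integral (fun x : borelX X => k%:num%:E * pot rho x)).
  apply: ge0_integralZl => //; first exact: measurable_pot.
  by move=> x _; exact: pot_ge0.
move=> x _; apply: ge0_integral_mscale => //; exact: measurable_kernel.
Qed.

(** Measures are compared on Borel sets only, so decompositions enter the energy through this
    congruence. *)
Lemma mutual_eq mu mu' nu nu' :
  (forall B : set (borelX X), measurable B -> mu B = mu' B) ->
  (forall B : set (borelX X), measurable B -> nu B = nu' B) ->
  mutual mu nu = mutual mu' nu'.
Proof.
move=> emu enu; rewrite /Defs.mutual (eq_integral (fun x : borelX X => pot nu' x)).
  by apply: eq_measure_integral => B mB _; exact: emu.
by move=> x _; apply: eq_measure_integral => B mB _; exact: enu.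
Qed.

Lemma mutual_mseriesl (mu_ : nat -> pmeas R X) rho : radon rho ->
  mutual (mseries mu_ 0) rho = \sum_(n <oo) mutual (mu_ n) rho.
Proof.
move=> rrho; apply: ge0_integral_measure_series => //.
  by move=> x _; exact: pot_ge0.
exact: measurable_pot.
Qed.

Lemma mutual_mseriesr mu (rho_ : nat -> pmeas R X) :
  (forall n, radon (rho_ n)) ->
  mutual mu (mseries rho_ 0) = \sum_(n <oo) mutual mu (rho_ n).
Proof.
move=> rrho; rewrite /Defs.mutual.
rewrite (eq_integral (fun x : borelX X => \sum_(n <oo) pot (rho_ n) x)).
  apply: integral_nneseries => //; first by move=> n; exact: measurable_pot.
  by move=> n x _; exact: pot_ge0.
move=> x _; apply: ge0_integral_measure_series => //.
exact: measurable_kernel.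
Qed.

Lemma mutual_add2 mu nu mu' nu' : radon mu' -> radon nu' ->
  mutual (measure_add mu nu) (measure_add mu' nu') =
  mutual mu mu' + mutual mu nu' + (mutual nu mu' + mutual nu nu').
Proof.
by move=> rmu rnu; rewrite mutual_addr// !mutual_addl// addeACA.
Qed.

End MutualEnergy.

(** * Jordan decomposition of a difference of finite measures *)

Section Jordan.
Context {R : realType} {X : ptopologicalType}.
Local Open Scope ereal_scope.
Implicit Types mu nu : pmeas R X.

(** Here s and t are the Jordan parts of mu - nu, and m is the minimum of mu and nu. Singularity of
    s and t is what makes (s, t) a signed measure in the sense of [signed_radon]. *)
Lemma common_part mu nu : mu setT < +oo -> nu setT < +oo ->
  exists s t m : pmeas R X, [/\
    (forall B : set (borelX X), measurable B -> mu B = measure_add s m B),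
    (forall B : set (borelX X), measurable B -> nu B = measure_add t m B) &
    exists B : set (borelX X), [/\ measurable B, s (~` B) = 0 & t B = 0]].
Proof.
move=> fmu fnu.
pose mu' : {finite_measure set (borelX X) -> \bar R} := mfrestr measurableT fmu.
pose nu' : {finite_measure set (borelX X) -> \bar R} := mfrestr measurableT fnu.
pose c : {charge set (borelX X) -> \bar R} :=
  cadd (charge_of_finite_measure mu') (copp (charge_of_finite_measure nu')).
have cE B : c B = mu B - nu B.
  by rewrite -[in RHS](setIT B).
have [P [N PN]] := Hahn_decomposition c.
have [[mP _] [mN _] PNT PN0] := PN.
(* On the positive Hahn set P the smaller measure is nu, on N it is mu; m is glued from these two
   restrictions. *)
exists (jordan_pos PN), (jordan_neg PN),
  (measure_add (mrestr mu mN) (mrestr nu mP)).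
have split (m : pmeas R X) B : measurable B -> m B = m (B `&` P) + m (B `&` N).
  move=> mB; rewrite -measureU; [|exact: measurableI|exact: measurableI|].
    by rewrite -setIUr PNT setIT.
  by rewrite setIACA PN0 setI0.
have posE0 B : measurable B -> jordan_pos PN B = mu (B `&` P) - nu (B `&` P).
  by move=> mB; rewrite jordan_posE cjordan_posE /crestr0 mem_set// /crestr cE.
have negE0 B : measurable B -> jordan_neg PN B = - (mu (B `&` N) - nu (B `&` N)).
  by move=> mB; rewrite jordan_negE cjordan_negE /crestr0 mem_set// /crestr cE.
have mE B : (measure_add (mrestr mu mN) (mrestr nu mP) : pmeas R X) B =
    mu (B `&` N) + nu (B `&` P) by exact: maddE.
have posE B (mB : measurable B) :
  (jordan_pos PN : pmeas R X) B = mu (B `&` P) - nu (B `&` P) := posE0 B mB.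
have negE B (mB : measurable B) :
  (jordan_neg PN : pmeas R X) B = - (mu (B `&` N) - nu (B `&` N)) := negE0 B mB.
split.
- move=> B mB; rewrite measure_addE [X in _ = X + _](posE B mB) [X in _ + X]mE (split mu B mB).
  have fP : nu (B `&` P) \is a fin_num.
    by apply: finite_measure_fin_num => //; exact: measurableI.
  by rewrite [mu _ + nu _]addeC addeA subeK.
- move=> B mB; rewrite measure_addE [X in _ = X + _](negE B mB) [X in _ + X]mE (split nu B mB).
  have fN : nu (B `&` N) \is a fin_num.
    by apply: finite_measure_fin_num => //; exact: measurableI.
  have fN' : mu (B `&` N) \is a fin_num.
    by apply: finite_measure_fin_num => //; exact: measurableI.
  by rewrite oppeB ?fin_num_adde_defr// addeA [_ + mu _]addeC addeA subee// add0e addeC.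
- exists P; split => //.
    by rewrite [LHS](posE _ (measurableC mP)) setICl !measure0 subee//.
  by rewrite [LHS](negE _ mP) PN0 !measure0 subee// oppe0.
Qed.

End Jordan.

(** * Positive definiteness for positive measures of finite energy *)

Section CauchySchwarz.
Context {R : realType} {X : ptopologicalType}.
Local Open Scope ereal_scope.
Context (kappa : X -> X -> \bar R).
Context (hX : hausdorff_space X).
Context (kappa_ge0 : forall x y, 0 <= kappa x y).
Context (kappa_lsc : lower_semicontinuous (fun p : X * X => kappa p.1 p.2)).
Context (kappa_pd : strictly_pd kappa).
Implicit Types mu nu rho : pmeas R X.
Local Notation mutual := (mutual kappa).

Lemma adde4_lty (a b c d : \bar R) :
  a + b + (c + d) < +oo -> 0 <= a -> 0 <= b -> 0 <= c -> 0 <= d ->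
  [/\ a \is a fin_num, b \is a fin_num, c \is a fin_num & d \is a fin_num].
Proof. by move: a b c d => [a| |] [b| |] [c| |] [d| |]. Qed.

Definition finite_energy mu := finite_radon mu /\ mutual mu mu < +oo.

(** Write mu = s + m and nu = t + m with s, t singular. All terms containing m add up to the same c
    on both sides, and a - b is the energy of (s, t). It is nonnegative, and it vanishes only if s =
    t = 0. *)
Lemma finite_energy_common mu nu : finite_energy mu -> finite_energy nu ->
  exists a b c : R, [/\ mutual mu mu + mutual nu nu = (a + c)%:E,
    mutual mu nu + mutual nu mu = (b + c)%:E, (b <= a)%R &
    (a = b -> forall B : set (borelX X), measurable B -> mu B = nu B)].
Proof.
move=> [frmu emu] [frnu enu].
have [rmu fmu] := frmu; have [rnu fnu] := frnu.
have [s [t [m [muE nuE sing]]]] := common_part fmu fnu.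
have les B : measurable B -> s B <= mu B by move=> mB; rewrite muE// measure_addE leeDl.
have lem B : measurable B -> m B <= mu B by move=> mB; rewrite muE// measure_addE leeDr.
have let' B : measurable B -> t B <= nu B by move=> mB; rewrite nuE// measure_addE leeDl.
have [rs fs] := finite_radon_le hX frmu les.
have [rm fm] := finite_radon_le hX frmu lem.
have [rt ft] := finite_radon_le hX frnu let'.
have mge0 := mutual_ge0 kappa_ge0.
have mumuE : mutual mu mu =
    mutual s s + mutual s m + (mutual m s + mutual m m).
  by rewrite -mutual_add2//; exact: mutual_eq.
have nunuE : mutual nu nu =
    mutual t t + mutual t m + (mutual m t + mutual m m).
  by rewrite -mutual_add2//; exact: mutual_eq.
have munuE : mutual mu nu =
    mutual s t + mutual s m + (mutual m t + mutual m m).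
  by rewrite -mutual_add2//; exact: mutual_eq.
have numuE : mutual nu mu =
    mutual t s + mutual t m + (mutual m s + mutual m m).
  by rewrite -mutual_add2//; exact: mutual_eq.
have sigst : signed_radon (s, t) by split.
have [pos def] := kappa_pd.
move: emu enu; rewrite mumuE nunuE.
move=> /adde4_lty[]// fss fsm fms fmm /adde4_lty[]// ftt ftm fmt _.
have {pos} := pos _ sigst; have {def} := def (s, t).
rewrite /in_E /senergy_defined /senergy /senergy_pos /senergy_neg /= munuE numuE.
have := mge0 s t; have := mge0 t s.
rewrite -(fineK fss) -(fineK fsm) -(fineK fms) -(fineK fmm).
rewrite -(fineK ftt) -(fineK ftm) -(fineK fmt).
move: (fine (mutual s s)) (fine (mutual s m)) (fine (mutual m s)) => ss sm ms.
move: (fine (mutual m m)) (fine (mutual t t)) (fine (mutual t m)) => mm tt tm.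
move: (fine (mutual m t)) => mt.
(* The energy of (s, t) is defined because its positive part is finite. An infinite cross term would
   make it -oo, against [pos]; so the cross terms are finite as well. *)
case: (mutual s t) => [st| |] //; case: (mutual t s) => [ts| |] // _ _ def pos.
all: have {}pos := pos ltac:(by case).
2,3,4: by move: pos.
exists (ss + tt)%R, (st + ts)%R, (sm + ms + mt + tm + 2 * mm)%R; split.
- by rewrite -!EFinD; congr EFin; ring.
- by rewrite -!EFinD; congr EFin; ring.
- by move: pos; rewrite -!EFinD lee_fin subr_ge0.
move=> E B mB; rewrite muE// nuE// !measure_addE.
have [||-> ->//] := def _ _ B mB.
- by split => //; rewrite -EFinD ltry.
- by rewrite -!EFinD E subrr.
Qed.

Lemma mutual_fin_num mu nu : finite_energy mu -> finite_energy nu ->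
  mutual mu nu \is a fin_num.
Proof.
move=> fmu fnu; have [a [b [c [_ + _ _]]]] := finite_energy_common fmu fnu.
have := mutual_ge0 kappa_ge0 mu nu; have := mutual_ge0 kappa_ge0 nu mu.
by case: (mutual mu nu) => [x| |]//; case: (mutual nu mu) => [y| |].
Qed.

(** Real values bring quadratic identities within reach of linear arithmetic. Since [fine] sends +oo
    to 0, the number is meaningful only when the mutual energy is finite. *)
Definition energy mu nu : R := fine (mutual mu nu).

Lemma energyE mu nu : finite_energy mu -> finite_energy nu ->
  mutual mu nu = (energy mu nu)%:E.
Proof. by move=> fmu fnu; rewrite /energy fineK// mutual_fin_num. Qed.

Lemma energy_ge0 mu nu : (0 <= energy mu nu)%R.
Proof. by apply: fine_ge0; exact: mutual_ge0. Qed.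

(** Nonnegativity of the energy of mu - nu, written without subtraction of measures.
    [energy_separates] is its equality case. *)
Lemma energy_triangle mu nu : finite_energy mu -> finite_energy nu ->
  (energy mu nu + energy nu mu <= energy mu mu + energy nu nu)%R.
Proof.
move=> fmu fnu; have [a [b [c [+ + ab _]]]] := finite_energy_common fmu fnu.
by rewrite !energyE// -!EFinD => -[->] [->]; rewrite lerD2r.
Qed.

Lemma energy_separates mu nu : finite_energy mu -> finite_energy nu ->
  (energy mu nu + energy nu mu = energy mu mu + energy nu nu)%R ->
  forall B : set (borelX X), measurable B -> mu B = nu B.
Proof.
move=> fmu fnu; have [a [b [c [+ + _ eq]]]] := finite_energy_common fmu fnu.
by rewrite !energyE// -!EFinD => -[->] [->] /addIr/esym.
Qed.

Lemma finite_energy_add mu nu : finite_energy mu -> finite_energy nu ->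
  finite_energy (measure_add mu nu).
Proof.
move=> fmu fnu; split; first exact: finite_radon_add fmu.1 fnu.1.
have [[rmu _] _] := fmu; have [[rnu _] _] := fnu.
by rewrite mutual_add2// !energyE// -!EFinD ltry.
Qed.

Lemma finite_energy_mscale (k : {nonneg R}) mu : finite_energy mu ->
  finite_energy (mscale k mu).
Proof.
move=> fmu; have rk := finite_radon_mscale k hX fmu.1; split => //.
have [[rmu _] _] := fmu.
rewrite mutual_scalel//; last exact: rk.1.
by rewrite mutual_scaler// energyE// -!EFinM ltry.
Qed.

Lemma energy_addl mu nu rho : finite_energy mu -> finite_energy nu ->
  finite_energy rho ->
  energy (measure_add mu nu) rho = (energy mu rho + energy nu rho)%R.
Proof.
move=> fmu fnu frho; have [[rrho _] _] := frho.
by rewrite {1}/energy mutual_addl// !energyE.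
Qed.

Lemma energy_addr mu nu rho : finite_energy mu -> finite_energy nu ->
  finite_energy rho ->
  energy rho (measure_add mu nu) = (energy rho mu + energy rho nu)%R.
Proof.
move=> fmu fnu frho; have [[rmu _] _] := fmu; have [[rnu _] _] := fnu.
by rewrite {1}/energy mutual_addr// !energyE.
Qed.

Lemma energy_scalel (k : {nonneg R}) mu rho : finite_energy mu ->
  finite_energy rho -> energy (mscale k mu) rho = (k%:num * energy mu rho)%R.
Proof.
move=> fmu frho; have [[rrho _] _] := frho.
by rewrite {1}/energy mutual_scalel// energyE.
Qed.

Lemma energy_scaler (k : {nonneg R}) mu rho : finite_energy mu ->
  finite_energy rho -> energy rho (mscale k mu) = (k%:num * energy rho mu)%R.
Proof.
move=> fmu frho; have [[rmu _] _] := fmu.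
by rewrite {1}/energy mutual_scaler// energyE.
Qed.

Lemma energy_add2 mu nu mu' nu' : finite_energy mu -> finite_energy nu ->
  finite_energy mu' -> finite_energy nu' ->
  energy (measure_add mu nu) (measure_add mu' nu') =
  (energy mu mu' + energy mu nu' + (energy nu mu' + energy nu nu'))%R.
Proof.
move=> fmu fnu fmu' fnu'; have fadd := finite_energy_add fmu' fnu'.
by rewrite (energy_addl fmu fnu fadd) (energy_addr fmu' fnu' fmu) (energy_addr fmu' fnu' fnu).
Qed.

Lemma energy_mscale_addl (k : {nonneg R}) mu nu rho : finite_energy mu ->
  finite_energy nu -> finite_energy rho ->
  energy (mscale k (measure_add mu nu)) rho =
  (k%:num * (energy mu rho + energy nu rho))%R.
Proof.
move=> fmu fnu frho; have fadd := finite_energy_add fmu fnu.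
by rewrite (energy_scalel k fadd frho) (energy_addl fmu fnu frho).
Qed.

Lemma energy_mscale_add2 (k : {nonneg R}) mu nu mu' nu' : finite_energy mu ->
  finite_energy nu -> finite_energy mu' -> finite_energy nu' ->
  energy (mscale k (measure_add mu nu)) (mscale k (measure_add mu' nu')) =
  (k%:num * (k%:num * (energy mu mu' + energy mu nu' +
                       (energy nu mu' + energy nu nu'))))%R.
Proof.
move=> fmu fnu fmu' fnu'; have fadd := finite_energy_add fmu fnu.
have fadd' := finite_energy_add fmu' fnu'.
rewrite (energy_scalel k fadd (finite_energy_mscale k fadd')).
by rewrite (energy_scaler k fadd' fadd) (energy_add2 fmu fnu fmu' fnu').
Qed.

End CauchySchwarz.

(** * Vector measures *)

Section CountableSums.
Context {R : realType} {I : countType}.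
Local Open Scope ereal_scope.

(** Series of measures run over the naturals, vector measures over I. The code [pickle] carries one
    sum to the other; numbers that encode no index contribute 0. *)
Lemma nneseries_pickle_inv (f : I -> \bar R) : (forall i, 0 <= f i) ->
  \sum_(n <oo) (if pickle_inv n is Some i then f i else 0) =
  \esum_(i in [set: I]) f i.
Proof.
move=> f0; rewrite nneseries_esumT; last by move=> n; case: pickle_inv.
rewrite (esum_mkcond [set: nat]).
rewrite (eq_esum (b := fun n => if n \in range (@pickle I) then
    (if pickle_inv n is Some i then f i else 0) else 0)); last first.
  move=> n _; rewrite in_setT; case: ifPn => //.
  case E : (pickle_inv n) => [i|//] /negP[]; rewrite inE.
  by exists i => //; have := @pickle_invK I n; rewrite E.
rewrite -esum_mkcond (@reindex_esum R I nat setT (range (@pickle I)) pickle).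
  by apply: eq_esum => i _; rewrite pickleK_inv.
by split => //; exact: in2W (pcan_inj pickleK).
Qed.

Lemma esum_bool (p : I -> bool) (f : I -> \bar R) : (forall i, 0 <= f i) ->
  \esum_(i in [set: I]) f i = \esum_(i in [set i | p i = true]) f i +
                              \esum_(i in [set i | p i = false]) f i.
Proof.
move=> f0; rewrite (esumID [set i | p i = true])//; congr (_ + _).
  by rewrite setTI.
by rewrite setTI; congr esum; apply/seteqP; split => i /=; case: (p i).
Qed.

End CountableSums.

Section SumMeasure.
Context {R : realType} {X : ptopologicalType} {I : countType}.
Local Open Scope ereal_scope.
Context (Ip : I -> bool).
Implicit Types mu nu : I -> pmeas R X.

(* [plate s mu] is the sum of the mu^i with Ip i = s, so that
   R mu = plate true mu - plate false mu. *)
Definition slot (s : bool) mu (n : nat) : pmeas R X :=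
  if pickle_inv n is Some i then (if Ip i == s then mu i else mzero) else mzero.

Definition plate (s : bool) mu : pmeas R X := mseries (slot s mu) 0.

(** An arbitrary functional F vanishing at the zero measure covers masses, integrals and mutual
    energies in either argument with one argument on indices. *)
Lemma slot_sum s mu (F : pmeas R X -> \bar R) : F mzero = 0 ->
  (forall m, 0 <= F m) ->
  \sum_(n <oo) F (slot s mu n) = \esum_(i in [set i | Ip i = s]) F (mu i).
Proof.
move=> F0 Fge0; rewrite (esum_mkcond [set i | Ip i = s]) -nneseries_pickle_inv.
  apply: eq_eseriesr => n _; rewrite /slot; case: pickle_inv => [i|//].
  by rewrite (_ : (i \in _) = (Ip i == s)) ?(fun_if F) ?F0//; apply/idP/eqP; rewrite inE.
by move=> i; case: ifP.
Qed.

Lemma plateE s mu (B : set (borelX X)) :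
  plate s mu B = \esum_(i in [set i | Ip i = s]) mu i B.
Proof. exact: (slot_sum s mu (F := fun m => m B)). Qed.

Lemma plate_integral s mu (D : set (borelX X)) (f : X -> \bar R) :
  measurable D -> (forall x, D x -> 0 <= f x) ->
  measurable_fun D (f : borelX X -> \bar R) ->
  \int[plate s mu]_(x in D) f x =
  \esum_(i in [set i | Ip i = s]) \int[mu i]_(x in D) f x.
Proof.
move=> mD f0 mf; rewrite [LHS]ge0_integral_measure_series//.
apply: (slot_sum s mu (F := fun m => \int[m]_(x in D) f x)).
  exact: integral_measure_zero.
by move=> m; exact: integral_ge0.
Qed.

Lemma slot_radon s mu n : hausdorff_space X ->
  (forall i, radon (mu i)) -> radon (slot s mu n).
Proof.
move=> hX rmu; rewrite /slot; have [r0 _] := finite_radon_mzero (R := R) hX.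
by case: pickle_inv => [i|//]; case: ifP.
Qed.

Lemma finite_radon_plate s mu : hausdorff_space X ->
  (forall i, finite_radon (mu i)) ->
  \esum_(i in [set: I]) mu i setT < +oo -> finite_radon (plate s mu).
Proof.
move=> hX rmu fin; apply: finite_radon_mseries => //.
  move=> n; rewrite /slot; have r0 := finite_radon_mzero (R := R) hX.
  by case: pickle_inv => [i|//]; case: ifP.
rewrite [X in X < _](plateE s mu setT) (le_lt_trans _ fin)//.
rewrite esum_mkcond; apply: le_esum => // i _.
by case: ifP.
Qed.

Context (kappa : X -> X -> \bar R).
Context (hX : hausdorff_space X).
Context (kappa_ge0 : forall x y, 0 <= kappa x y).
Context (kappa_lsc : lower_semicontinuous (fun p : X * X => kappa p.1 p.2)).
Local Notation mutual := (mutual kappa).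

Lemma mutual_mzerol (m : pmeas R X) : mutual mzero m = 0.
Proof. exact: integral_measure_zero. Qed.

Lemma mutual_mzeror (m : pmeas R X) : mutual m mzero = 0.
Proof.
rewrite /Defs.mutual (eq_integral (fun=> 0)) ?integral0//.
by move=> x _; exact: integral_measure_zero.
Qed.

Lemma mutual_platel s mu (rho : pmeas R X) : radon rho ->
  mutual (plate s mu) rho = \esum_(i in [set i | Ip i = s]) mutual (mu i) rho.
Proof.
move=> rrho; rewrite mutual_mseriesl//.
apply: (slot_sum s mu (F := fun m => mutual m rho)).
  exact: mutual_mzerol.
by move=> m; exact: mutual_ge0.
Qed.

Lemma mutual_plater s (rho : pmeas R X) mu : (forall i, radon (mu i)) ->
  mutual rho (plate s mu) = \esum_(i in [set i | Ip i = s]) mutual rho (mu i).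
Proof.
move=> rmu; rewrite mutual_mseriesr//; last by move=> n; exact: slot_radon.
apply: (slot_sum s mu (F := fun m => mutual rho m)).
  exact: mutual_mzeror.
by move=> m; exact: mutual_ge0.
Qed.

Lemma mutual_plate2 s t mu nu : (forall i, radon (nu i)) ->
  radon (plate t nu) ->
  mutual (plate s mu) (plate t nu) =
  \esum_(p in [set p : I * I | Ip p.1 = s /\ Ip p.2 = t])
     mutual (mu p.1) (nu p.2).
Proof.
move=> rnu rp; rewrite mutual_platel//.
under eq_esum do rewrite mutual_plater//.
rewrite (esum_esum (a := fun i j => mutual (mu i) (nu j))); last first.
  by move=> *; exact: mutual_ge0.
by congr esum; apply/seteqP; split.
Qed.

(** A pair of indices of equal sign lies wholly in I^+ or wholly in I^-. Together with
    [venergy_negE] this identifies the energy of the vector measure with that of R mu. *)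
Lemma venergy_posE mu : (forall i, radon (mu i)) ->
  (forall s, radon (plate s mu)) ->
  venergy_pos kappa Ip mu = mutual (plate true mu) (plate true mu) +
                            mutual (plate false mu) (plate false mu).
Proof.
move=> rmu rp; rewrite /venergy_pos (esumID [set p | Ip p.1 = true]); last first.
  by move=> *; exact: mutual_ge0.
rewrite !mutual_plate2//; congr (_ + _); congr esum; apply/seteqP; split => -[i j] /=;
  case: (Ip i); case: (Ip j) => //; by [case|move=> [_ /(_ erefl)]].
Qed.

Lemma venergy_negE mu : (forall i, radon (mu i)) ->
  (forall s, radon (plate s mu)) ->
  venergy_neg kappa Ip mu = mutual (plate true mu) (plate false mu) +
                            mutual (plate false mu) (plate true mu).
Proof.
move=> rmu rp; rewrite /venergy_neg (esumID [set p | Ip p.1 = true]); last first.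
  by move=> *; exact: mutual_ge0.
rewrite !mutual_plate2//; congr (_ + _); congr esum; apply/seteqP; split => -[i j] /=;
  case: (Ip i); case: (Ip j) => //; by [case|move=> [_ /(_ erefl)]].
Qed.

Lemma field_posE chi mu : radon chi.1 -> radon chi.2 ->
  field_pos kappa Ip chi mu =
  mutual (plate true mu) chi.1 + mutual (plate false mu) chi.2.
Proof.
move=> r1 r2; rewrite /field_pos (esum_bool Ip); last first.
  by move=> i; case: ifP => _; exact: mutual_ge0.
rewrite !mutual_platel//.
by congr (_ + _); apply: eq_esum => i /= ->.
Qed.

Lemma field_negE chi mu : radon chi.1 -> radon chi.2 ->
  field_neg kappa Ip chi mu =
  mutual (plate true mu) chi.2 + mutual (plate false mu) chi.1.
Proof.
move=> r1 r2; rewrite /field_neg (esum_bool Ip); last first.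
  by move=> i; case: ifP => _; exact: mutual_ge0.
rewrite !mutual_platel//.
by congr (_ + _); apply: eq_esum => i /= ->.
Qed.

Context (kappa_pd : strictly_pd kappa).
Local Notation energy := (energy kappa).

(** For R mu = u - v and chi = chi1 - chi2 this is ||R mu||^2 + 2 kappa(chi, R mu), expanded into
    mutual energies of positive measures. *)
Definition gauss (chi1 chi2 u v : pmeas R X) : R :=
  (energy u u + energy v v - (energy u v + energy v u) +
   2 * (energy u chi1 + energy v chi2 - (energy u chi2 + energy v chi1)))%R.

Lemma GchiE chi mu : finite_energy kappa chi.1 -> finite_energy kappa chi.2 ->
  (forall i, radon (mu i)) -> (forall s, finite_energy kappa (plate s mu)) ->
  Gchi kappa Ip chi mu = (gauss chi.1 chi.2 (plate true mu) (plate false mu))%:E.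
Proof.
move=> f1 f2 rmu fp; have [[r1 _] _] := f1; have [[r2 _] _] := f2.
have rp s : radon (plate s mu) by case: (fp s) => -[].
rewrite /Gchi /venergy venergy_posE// venergy_negE// field_posE// field_negE//.
by rewrite !energyE//.
Qed.

End SumMeasure.

(** * Measures of small energy *)

Section Concentrated.
Context {R : realType} {X : ptopologicalType}.
Local Open Scope ereal_scope.
Context (hX : hausdorff_space X).
Implicit Types mu nu : pmeas R X.

Lemma outer_measE mu (B : set (borelX X)) : measurable B ->
  outer_meas mu B = mu B.
Proof.
move=> mB; apply/eqP; rewrite eq_le; apply/andP; split.
  by apply: ereal_inf_lbound; exists B => //; split.
apply: le_ereal_inf_tmp => _ [C [mC BC] <-].
by apply: le_measure; rewrite ?inE.
Qed.

(** The complement of E is open, so by inner regularity it is null as soon as its compact subsets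
    are: local negligibility becomes negligibility. *)
Lemma concentrated_closed mu (E : set X) : closed E -> radon mu ->
  concentrated mu E <-> mu (~` E) = 0.
Proof.
move=> cE [_ _ inner]; have mE := closed_borel cE; split=> [cmu|mu0 K cK].
  have oE : open (~` E) by exact: closed_openC.
  apply/eqP; rewrite eq_le measure_ge0 andbT (inner _ oE).
  apply: ge_ereal_sup => _ [K [cK KE] <-].
  have := cmu K cK; rewrite (_ : K `\` E = K).
    by rewrite outer_measE; [move=> ->|exact: compact_borel].
  by apply/seteqP; split => x; [case|move=> Kx; split => //; exact: KE].
rewrite outer_measE; last by apply: measurableD => //; exact: compact_borel.
apply/eqP; rewrite eq_le measure_ge0 andbT -mu0.
apply: le_measure; rewrite ?inE//.
- by apply: measurableD => //; exact: compact_borel.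
- exact: measurableC.
Qed.

Lemma measure_concentratedT mu (E : set (borelX X)) : measurable E ->
  mu (~` E) = 0 -> mu setT = mu E.
Proof. by move=> mE mu0; rewrite -(setUv E) measureU0//; exact: measurableC. Qed.

Lemma integral_concentrated mu (E D : set (borelX X)) (f : X -> \bar R) :
  measurable E -> measurable D -> E `<=` D -> mu (~` E) = 0 ->
  (forall x, D x -> 0 <= f x) -> measurable_fun D (f : borelX X -> \bar R) ->
  \int[mu]_(x in D) f x = \int[mu]_(x in E) f x.
Proof.
move=> mE mD ED mu0 f0 mf.
have DE : D = E `|` (D `\` E) by rewrite setDUK.
have mDE : measurable (D `\` E) by exact: measurableD.
have nul : mu (D `\` E) = 0.
  apply/eqP; rewrite eq_le measure_ge0 andbT -mu0.
  by apply: le_measure; rewrite ?inE//; exact: measurableC.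
rewrite {1}DE ge0_integral_setU//.
- rewrite [X in _ + X]null_set_integral// ?adde0//.
  by apply: measurable_funS mf => // x [].
- by rewrite -DE.
- by rewrite -DE.
- by rewrite disj_set2E; apply/eqP/seteqP; split => x // [Ex []].
Qed.

Lemma within_continuous_measurable (D : set X) (g : X -> R) :
  measurable (D : set (borelX X)) -> {within D, continuous g} ->
  measurable_fun (D : set (borelX X)) (EFin \o g : borelX X -> \bar R).
Proof.
move=> mD /continuousP cg; apply/measurable_EFinP.
apply: (measurability _ (RGenOpens.measurableE R)).
move=> _ [_ [a [b ->] <-]].
have /open_subspaceP[V oV VE] := cg `]a, b[%classic (@interval_open _ (BRight a) (BLeft b) isT isT).
rewrite setIC -[_ `&` _]VE; apply: measurableI => //; exact: open_borel.
Qed.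

End Concentrated.

Section SmallEnergy.
Context {R : realType} {X : ptopologicalType}.
Local Open Scope ereal_scope.
Context (kappa : X -> X -> \bar R).
Context (hX : hausdorff_space X).
Context (kappa_ge0 : forall x y, 0 <= kappa x y).
Context (kappa_lsc : lower_semicontinuous (fun p : X * X => kappa p.1 p.2)).
Implicit Types mu nu : pmeas R X.
Local Notation mutual := (mutual kappa).

Lemma mass_le_integral mu (E : set X) (g : X -> R) (c : R) : closed E ->
  mu (~` E) = 0 -> {within E, continuous g} -> (0 < c)%R ->
  (forall x, E x -> (c <= g x)%R) ->
  c%:E * mu setT <= \int[mu]_(x in E) (g x)%:E.
Proof.
move=> cE mu0 cg c0 cg_le; have mE := closed_borel cE.
have -> : mu setT = mu E.
  exact: measure_concentratedT.
rewrite -integral_cst//; apply: ge0_le_integral => //.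
- by move=> x _; rewrite lee_fin ltW.
- exact: within_continuous_measurable.
Qed.

(** The value +oo arises only from the branch m = 0, so unit masses of arbitrarily small energy
    exist. *)
Lemma inner_cap_infty (E : set X) (e : R) : inner_cap kappa E = +oo ->
  (0 < e)%R -> exists nu, [/\ Eplus_on kappa E nu, outer_meas nu E = 1 &
    mutual nu nu < e%:E].
Proof.
rewrite /inner_cap; set m := ereal_inf _; case: eqP => [m0 _ e0|_]; last by case: ifP.
have : m < e%:E by rewrite m0 lte_fin.
by move=> /ereal_inf_lt[_ [nu [? ?] <-] ?]; exists nu.
Qed.

(** A unit measure on E of tiny energy may give g an infinite integral. Its restriction to a compact
    set gives a finite one, bounded away from 0, and can be rescaled to the value d. *)
Lemma small_energy (E : set X) (g : X -> R) (c d e : R) :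
  inner_cap kappa E = +oo -> closed E -> {within E, continuous g} ->
  (0 < c)%R -> (forall x, E x -> (c <= g x)%R) -> (0 <= d)%R -> (0 < e)%R ->
  exists sigma, [/\ finite_radon sigma, sigma (~` E) = 0,
    \int[sigma]_(x in E) (g x)%:E = d%:E & mutual sigma sigma <= e%:E].
Proof.
move=> capE cE cg c0 cg_le d0 e0; have mE := closed_borel cE.
(* A restriction keeping half of the mass has integral at least c/2, so the scaling factor will be
   at most q and the energy grows by at most q^2. The 1 in q^2 + 1 keeps the divisor positive when d
   = 0. *)
pose q := (2 * d / c)%R.
have q0 : (0 <= q)%R by rewrite /q divr_ge0 ?mulr_ge0// ltW.
have q1 : (0 < q ^+ 2 + 1)%R by rewrite ltr_wpDl// sqr_ge0.
have [nu [[[rnu enu] cnu] nuE1 nu_lt]] :=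
  inner_cap_infty capE (divr_gt0 e0 q1).
have /(concentrated_closed hX cE rnu) nu0 := cnu.
move: nuE1; rewrite outer_measE// => nuE1.
have nuT : nu setT = 1 by rewrite (@measure_concentratedT _ _ _ E).
have fnu : nu setT < +oo by rewrite nuT ltry.
have [_ _ inner] := rnu.
have [_ [K [cK _] <-] K2] : exists2 y, [set nu K | K in [set K : set X |
    compact K /\ K `<=` setT]] y & (2^-1)%:E < y.
  have := inner setT openT; set s := ereal_sup _ => sE.
  have : (2^-1)%:E < s by rewrite -sE nuT lte_fin invf_lt1// ltr1n.
  by move/ereal_sup_gt => [y yK yl]; exists y.
have mK := compact_borel hX cK.
have mKC := measurableC mK.
pose nu' : pmeas R X := mrestr nu mK.
pose nu'' : pmeas R X := mrestr nu mKC.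
have nu'E B : nu' B = nu (B `&` K) by [].
have nuD B : measurable B -> nu B = (measure_add nu' nu'' : pmeas R X) B.
  move=> mB; rewrite maddE (_ : nu' B + nu'' B = nu (B `&` K) + nu (B `&` ~` K))//.
  rewrite -measureU; [|exact: measurableI|exact: measurableI|].
    by rewrite -setIUr setUv setIT.
  by rewrite setIACA setICr setI0.
have le' B : measurable B -> nu' B <= nu B.
  by move=> mB; rewrite nuD// maddE leeDl.
have le'' B : measurable B -> nu'' B <= nu B.
  by move=> mB; rewrite nuD// maddE leeDr.
have fr' : finite_radon nu' by exact: (finite_radon_le hX (conj rnu fnu)).
have fr'' : finite_radon nu'' by exact: (finite_radon_le hX (conj rnu fnu)).
have [r' _] := fr'; have [r'' _] := fr''.
have en' : mutual nu' nu' <= mutual nu nu.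
  rewrite (mutual_eq kappa nuD nuD) mutual_add2// -addeA leeDl//.
  by apply: adde_ge0; [|apply: adde_ge0]; exact: mutual_ge0.
have nu'0 : nu' (~` E) = 0.
  by apply/eqP; rewrite eq_le measure_ge0 andbT -nu0 le'//; exact: measurableC.
have mg : measurable_fun (E : set (borelX X)) (EFin \o g : borelX X -> \bar R).
  exact: within_continuous_measurable.
have g0 x : E x -> 0 <= (g x)%:E.
  by move=> Ex; rewrite lee_fin (le_trans (ltW c0)) ?cg_le.
pose J := \int[nu']_(x in E) (g x)%:E.
have nuK : nu' setT = nu K by rewrite nu'E setTI.
have Jlow : (c / 2)%:E <= J.
  apply: le_trans (mass_le_integral cE nu'0 cg c0 cg_le).
  by rewrite nuK EFinM lee_pmul2l// ltW.
have cKE : compact (K `&` E) by exact: compact_closedI.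
(* Continuity bounds g on the compact set, which makes the integral J finite. *)
have [M ME] : exists M : R, forall x, (K `&` E) x -> (g x <= M)%R.
  have cgKE : {within K `&` E, continuous g}.
    by apply: continuous_subspaceW cg => x [].
  have := compact_bounded (continuous_compact cgKE cKE : compact ((g : X -> R^o) @` (K `&` E))).
  move=> [M [Mr MB]]; exists (M + 1)%R => x Kx.
  have := MB (M + 1)%R; rewrite ltrDl ltr01 => /(_ isT (g x)).
  move=> /(_ _)/(le_trans (ler_norm _)); apply.
  by exists x.
have Jup : J < +oo.
  have mKE : measurable (K `&` E : set (borelX X)) by exact: measurableI.
  rewrite /J (@integral_concentrated _ _ nu' (K `&` E) E)//; last first.
    rewrite setCI; apply/eqP; rewrite eq_le measure_ge0 andbT.
    apply: le_trans (measureU2 nu' mKC (measurableC mE)) _.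
    by rewrite [X in _ + X]nu'0 [X in X + _]nu'E setICl measure0 adde0.
  apply: (@le_lt_trans _ _ (M%:E * nu' (K `&` E))).
    rewrite -integral_cst//; apply: ge0_le_integral => //.
    - by move=> x [_ /g0].
    - by apply: measurable_funS mg => // x [].
  have fKE : nu' (K `&` E) \is a fin_num.
    by apply: finite_measure_fin_num => //; exact: fr'.2.
  by rewrite -(fineK fKE) -EFinM ltry.
have Jfin : J \is a fin_num.
  by rewrite ge0_fin_numE// (le_trans _ Jlow)// lee_fin divr_ge0// ltW.
pose j := fine J.
have JE : J = j%:E by rewrite /j fineK.
have j0 : (0 < j)%R.
  by rewrite -lte_fin -JE (lt_le_trans _ Jlow)// lte_fin divr_gt0.
have cj : (c / 2 <= j)%R by rewrite -lee_fin -JE.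
have dj0 : (0 <= d / j)%R by rewrite divr_ge0// ltW.
pose k := NngNum dj0.
exists (mscale k nu'); split.
- exact: finite_radon_mscale.
- by rewrite /= /mscale [X in _ * X]nu'0 mule0.
- by rewrite ge0_integral_mscale//= -/J JE -EFinM divfK// gt_eqF.
- have rk : radon (mscale k nu') by case: (finite_radon_mscale k hX fr').
  rewrite mutual_scalel// mutual_scaler//= muleA -EFinM.
  have djq : (d / j <= q)%R.
    rewrite ler_pdivrMr// /q mulrAC ler_pdivlMr//; nra.
  apply: (@le_trans _ _ ((q ^+ 2)%:E * (e / (q ^+ 2 + 1))%:E)).
    apply: lee_pmul.
    + by rewrite lee_fin mulr_ge0.
    + exact: mutual_ge0.
    + by rewrite lee_fin expr2 ler_pM.
    + by apply: le_trans en' _; exact: ltW.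
  rewrite -EFinM lee_fin mulrCA ler_piMr ?(ltW e0)//.
  by rewrite ler_pdivrMr// mul1r lerDl.
Qed.

End SmallEnergy.

(** * The Gauss functional *)

Section EsumExtra.
Context {R : realType}.
Local Open Scope ereal_scope.

Lemma esumZl (I : countType) (f : I -> \bar R) (k : R) : (0 <= k)%R ->
  (forall i, 0 <= f i) ->
  \esum_(i in [set: I]) (k%:E * f i) = k%:E * \esum_(i in [set: I]) f i.
Proof.
move=> k0 f0; rewrite -!nneseries_pickle_inv//; last by move=> i; rewrite mule_ge0.
rewrite -nneseriesZl//; last by move=> n _; case: pickle_inv.
by apply: eq_eseriesr => n _; case: pickle_inv => //; rewrite mule0.
Qed.

(** Finiteness of the sums allows cancellation: the nonnegative differences h - f have sum 0, so
    each of them vanishes. *)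
Lemma esum_le_eq (I : choiceType) (S : set I) (f h : I -> \bar R) :
  (forall i, S i -> 0 <= f i <= h i) ->
  \esum_(i in S) h i < +oo -> \esum_(i in S) f i = \esum_(i in S) h i ->
  forall i, S i -> f i = h i.
Proof.
move=> fh hfin eq i Si.
have S0 j : S j -> 0 <= f j by move=> /fh/andP[].
have S1 j : S j -> 0 <= h j by move=> /fh/andP[]; exact: le_trans.
have hj j : S j -> h j \is a fin_num.
  move=> Sj; rewrite ge0_fin_numE ?S1// (le_lt_trans _ hfin)//.
  apply: esum_ge; exists [set j]; last by rewrite fsbig_set1.
  by split; [exact: finite_set1|move=> ? ->].
have fj j : S j -> f j \is a fin_num.
  move=> Sj; have /andP[f0 fhj] := fh j Sj; rewrite ge0_fin_numE//.
  by rewrite (le_lt_trans fhj)// ltey_eq hj.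
have D0 j : S j -> 0 <= h j - f j.
  by move=> Sj; rewrite sube_ge0 ?fj//; case/andP: (fh j Sj).
have : \esum_(j in S) h j = \esum_(j in S) f j + \esum_(j in S) (h j - f j).
  rewrite -esumD//; apply: eq_esum => j Sj.
  by rewrite addeC subeK ?fj.
have esf : \esum_(j in S) f j \is a fin_num.
  by rewrite ge0_fin_numE ?esum_ge0// eq.
have cancel (x y : \bar R) : x \is a fin_num -> 0 <= y -> x = x + y -> y = 0.
  move: x y => [x| |] [y| |]// _ _ [/eqP].
  by rewrite -subr_eq0 opprD addrA subrr add0r oppr_eq0 => /eqP ->.
rewrite -eq => /(cancel _ _ esf (esum_ge0 D0)) D.
apply/eqP; rewrite eq_le; have /andP[_ ->]/= := fh i Si.
rewrite -sube_le0 ?fj// -D.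
apply: esum_ge; exists [set i]; last by rewrite fsbig_set1.
by split; [exact: finite_set1|move=> ? ->].
Qed.

End EsumExtra.

Section PlateAlgebra.
Context {R : realType} {X : ptopologicalType} {I : countType}.
Local Open Scope ereal_scope.
Context (Ip : I -> bool).
Implicit Types mu nu : I -> pmeas R X.

Lemma plate_add s mu nu (B : set (borelX X)) :
  plate Ip s (fun i => measure_add (mu i) (nu i)) B =
  (measure_add (plate Ip s mu) (plate Ip s nu) : pmeas R X) B.
Proof.
rewrite maddE !plateE -esumD//; apply: eq_esum => i _; exact: maddE.
Qed.

Lemma plate_mscale s mu (k : {nonneg R}) (B : set (borelX X)) :
  plate Ip s (fun i => mscale k (mu i)) B =
  (mscale k (plate Ip s mu) : pmeas R X) B.
Proof.
rewrite [RHS]/= /mscale !plateE !(esum_mkcond [set i | Ip i = s]).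
rewrite -esumZl//; last by move=> i; case: ifP.
by apply: eq_esum => i _; case: ifP; rewrite ?mule0.
Qed.

End PlateAlgebra.

Section GaussFunctional.
Context {R : realType} {X : ptopologicalType} {I : countType}.
Context (kappa : X -> X -> \bar R).
Context (hX : hausdorff_space X).
Context (kappa_ge0 : forall x y, (0 <= kappa x y)%E).
Context (kappa_lsc : lower_semicontinuous (fun p : X * X => kappa p.1 p.2)).
Context (kappa_pd : strictly_pd kappa).
Local Notation mutual := (mutual kappa).
Local Notation energy := (energy kappa).
Local Notation gauss := (gauss kappa).
Local Notation finite_energy := (finite_energy kappa).
Implicit Types mu nu u v T : pmeas R X.

Lemma gauss_eq chi1 chi2 u u' v v' :
  (forall B : set (borelX X), measurable B -> u B = u' B) ->
  (forall B : set (borelX X), measurable B -> v B = v' B) ->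
  gauss chi1 chi2 u v = gauss chi1 chi2 u' v'.
Proof.
move=> eu ev; rewrite /gauss /energy.
by rewrite !(mutual_eq kappa eu eu) !(mutual_eq kappa eu ev) !(mutual_eq kappa ev eu)
  !(mutual_eq kappa ev ev) !(mutual_eq kappa eu (fun B _ => erefl))
  !(mutual_eq kappa ev (fun B _ => erefl)).
Qed.

Lemma finite_energy_eq u u' :
  (forall B : set (borelX X), measurable B -> u B = u' B) ->
  finite_energy u -> finite_energy u'.
Proof.
move=> eu [fu e]; split; last by rewrite -(mutual_eq kappa eu eu).
by apply: (finite_radon_le hX fu) => B mB; rewrite eu.
Qed.

(** Apply [energy_triangle] to r v and T, then divide by r: the right side is at most r^2 times the
    energy of v, plus r^2. *)
Lemma energy_cross v T (r : R) : finite_energy v -> finite_energy T ->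
  0 < r -> energy T T <= r ^+ 2 -> energy v T + energy T v <= r * (energy v v + 1).
Proof.
move=> fv fT r0 Tr; pose k := NngNum (ltW r0).
have fkv := finite_energy_mscale hX kappa_ge0 kappa_lsc kappa_pd k fv.
have := energy_triangle hX kappa_ge0 kappa_lsc kappa_pd fkv fT.
rewrite energy_scalel// !energy_scaler// energy_scalel//= => H.
rewrite -(ler_pM2l r0).
apply: (le_trans (y := r * energy v T + r * energy T v)); first by rewrite mulrDr.
apply: (le_trans H).
by rewrite mulrDr mulr1 mulrDr lerD2l.
Qed.

(** Adding T on the negative side makes its interactions with u and chi1 enter with a minus sign, so
    they are dropped. The cross term with v costs r (||v||^2 + 1), that with chi2 at most 2 r
    (||chi2||^2 + 1), and the energy of T at most r since r <= 1. *)
Lemma gauss_perturb chi1 chi2 u v T (r : R) : finite_energy chi1 ->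
  finite_energy chi2 -> finite_energy u -> finite_energy v ->
  finite_energy T -> 0 < r -> r <= 1 -> energy T T <= r ^+ 2 ->
  gauss chi1 chi2 u (measure_add v T) <=
  gauss chi1 chi2 u v + r * (4 + energy v v + 2 * energy chi2 chi2).
Proof.
move=> f1 f2 fu fv fT r0 r1 Tr.
have fvT := finite_energy_add hX kappa_ge0 kappa_lsc kappa_pd fv fT.
have h1 := energy_cross fv fT r0 Tr.
have h2 := energy_cross f2 fT r0 Tr.
rewrite /gauss (energy_add2 hX kappa_ge0 kappa_lsc kappa_pd fv fT fv fT).
have addl := energy_addl hX kappa_ge0 kappa_lsc kappa_pd fv fT.
rewrite (energy_addr hX kappa_ge0 kappa_lsc kappa_pd fv fT fu).
rewrite (addl _ fu) (addl _ f1) (addl _ f2).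
have Tle : energy T T <= r by apply: (le_trans Tr); rewrite expr2 ler_piMr// ltW.
have := energy_ge0 kappa_ge0 u T; have := energy_ge0 kappa_ge0 T u.
have := energy_ge0 kappa_ge0 T chi1; have := energy_ge0 kappa_ge0 chi2 T.
move: h1 h2 Tle; rewrite !mulrDr; clear.
generalize (energy u u) (energy v v) (energy T T) (energy v T) (energy T v).
generalize (energy u v) (energy v u) (energy u T) (energy T u).
generalize (energy T chi1) (energy T chi2) (energy chi2 T) (energy chi2 chi2).
generalize (energy u chi1) (energy u chi2) (energy v chi1) (energy v chi2).
by move=> *; lra.
Qed.

(** At the midpoint the functional equals the average of the two values minus a quarter of ||(u1 -
    v1) - (u2 - v2)||^2. By the hypotheses this norm vanishes. *)
Lemma gauss_midpoint chi1 chi2 u1 v1 u2 v2 (k : {nonneg R}) : k%:num = 2^-1 ->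
  finite_energy chi1 -> finite_energy chi2 ->
  finite_energy u1 -> finite_energy v1 -> finite_energy u2 -> finite_energy v2 ->
  gauss chi1 chi2 u1 v1 <= gauss chi1 chi2 (mscale k (measure_add u1 u2))
    (mscale k (measure_add v1 v2)) ->
  gauss chi1 chi2 u2 v2 = gauss chi1 chi2 u1 v1 ->
  forall B : set (borelX X), measurable B ->
    measure_add u1 v2 B = measure_add u2 v1 B.
Proof.
move=> k2 f1 f2 fu1 fv1 fu2 fv2.
have add u v := @finite_energy_add _ _ _ hX kappa_ge0 kappa_lsc kappa_pd u v.
(* The difference of u1 - v1 and u2 - v2 is that of the positive measures u1 + v2 and u2 + v1, to
   which [energy_separates] applies. *)
have fP := add _ _ fu1 fv2; have fQ := add _ _ fu2 fv1.
move=> mid eq; apply: (energy_separates hX kappa_ge0 kappa_lsc kappa_pd fP fQ).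
apply/eqP; rewrite eq_le (energy_triangle hX kappa_ge0 kappa_lsc kappa_pd fP fQ).
move: mid eq; rewrite /gauss /=.
have bil p q p' q' := @energy_mscale_add2 _ _ _ hX kappa_ge0 kappa_lsc kappa_pd k p q p' q'.
have lin p q p' := @energy_mscale_addl _ _ _ hX kappa_ge0 kappa_lsc kappa_pd k p q p'.
have add2 p q p' q' := @energy_add2 _ _ _ hX kappa_ge0 kappa_lsc kappa_pd p q p' q'.
rewrite (bil _ _ _ _ fu1 fu2 fu1 fu2) (bil _ _ _ _ fv1 fv2 fv1 fv2).
rewrite (bil _ _ _ _ fu1 fu2 fv1 fv2) (bil _ _ _ _ fv1 fv2 fu1 fu2).
rewrite (lin _ _ _ fu1 fu2 f1) (lin _ _ _ fu1 fu2 f2).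
rewrite (lin _ _ _ fv1 fv2 f1) (lin _ _ _ fv1 fv2 f2) k2.
rewrite (add2 _ _ _ _ fu1 fv2 fu1 fv2) (add2 _ _ _ _ fu2 fv1 fu2 fv1).
rewrite (add2 _ _ _ _ fu1 fv2 fu2 fv1) (add2 _ _ _ _ fu2 fv1 fu1 fv2); clear.
generalize (energy u1 u1) (energy u1 v1) (energy u1 u2) (energy u1 v2).
generalize (energy v1 u1) (energy v1 v1) (energy v1 u2) (energy v1 v2).
generalize (energy u2 u1) (energy u2 v1) (energy u2 u2) (energy u2 v2).
generalize (energy v2 u1) (energy v2 v1) (energy v2 u2) (energy v2 v2).
generalize (energy u1 chi1) (energy u1 chi2) (energy u2 chi1) (energy u2 chi2).
generalize (energy v1 chi1) (energy v1 chi2) (energy v2 chi1) (energy v2 chi2).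
by move=> *; lra.
Qed.

Local Open Scope ereal_scope.

(** Mixed energies of the sigma^i are at most 2d by [energy_triangle]. The weights 1/2^(n+1) have
    sum at most 1, and so does the double series of their products. *)
Lemma plate_small_energy (Ip : I -> bool) s (sigma : I -> pmeas R X)
    (w : I -> {nonneg R}) (d : R) :
  (forall i, (w i)%:num = (1 / (2 ^ (pickle i).+1)%:R)%R) ->
  (forall i, finite_radon (sigma i)) -> (0 <= d)%R ->
  (forall i, mutual (sigma i) (sigma i) <= d%:E) ->
  radon (plate Ip s (fun i => mscale (w i) (sigma i))) ->
  mutual (plate Ip s (fun i => mscale (w i) (sigma i)))
         (plate Ip s (fun i => mscale (w i) (sigma i))) <= (2 * d)%:E.
Proof.
move=> wE rs d0 sd rp; set tau := fun i => _.
have fs i : finite_energy (sigma i).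
  by split => //; apply: le_lt_trans (sd i) _; rewrite ltry.
have d20 : (0 <= 2 * d)%R by rewrite mulr_ge0.
have rt i : radon (tau i) by case: (finite_radon_mscale (w i) hX (rs i)).
have bound n k : mutual (slot Ip s tau n) (slot Ip s tau k) <=
    (2 * d / (2 ^ n.+1)%:R / (2 ^ k.+1)%:R)%:E.
  have r0 : 0 <= (2 * d / (2 ^ n.+1)%:R / (2 ^ k.+1)%:R)%:E.
    by rewrite lee_fin !divr_ge0.
  rewrite /slot.
  case En : (pickle_inv n) => [i|]; last by rewrite mutual_mzerol.
  case: ifP => _; last by rewrite mutual_mzerol.
  case Ek : (pickle_inv k) => [j|]; last by rewrite mutual_mzeror.
  case: ifP => _; last by rewrite mutual_mzeror.
  have [[ri _] _] := fs i; have [[rj _] _] := fs j.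
  have ni : pickle i = n by have := @pickle_invK I n; rewrite En.
  have kj : pickle j = k by have := @pickle_invK I k; rewrite Ek.
  rewrite /tau mutual_scalel//; last exact: rt.
  rewrite mutual_scaler// energyE// -!EFinM lee_fin !wE ni kj !mul1r.
  have sij : (energy (sigma i) (sigma j) <= 2 * d)%R.
    have tri := energy_triangle hX kappa_ge0 kappa_lsc kappa_pd (fs i) (fs j).
    have /le_trans : (energy (sigma i) (sigma j) <=
        energy (sigma i) (sigma j) + energy (sigma j) (sigma i))%R.
      by rewrite lerDl energy_ge0.
    apply; apply: (le_trans tri).
    have sdR l : (energy (sigma l) (sigma l) <= d)%R.
      by rewrite -lee_fin -(energyE hX kappa_ge0 kappa_lsc kappa_pd (fs l) (fs l)).
    by rewrite mulr2n mulrDl !mul1r lerD.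
  rewrite -[leRHS]mulrA [leRHS]mulrC !mulrA -[leRHS]mulrA.
  by rewrite ler_wpM2l// -invfM invr_ge0.
rewrite mutual_mseriesl//.
apply: le_trans (epsilon_trick0 xpredT d20).
apply: lee_nneseries => [n _ _|n _]; first exact: mutual_ge0.
rewrite mutual_mseriesr//; last by move=> k; exact: slot_radon.
apply: le_trans (epsilon_trick0 xpredT _); last by rewrite divr_ge0.
by apply: lee_nneseries => [k _ _|k _]; [exact: mutual_ge0|exact: bound].
Qed.

End GaussFunctional.

(** * Admissible vector measures, approximation and comparison of minimizers *)

Section GaussProblem.
Context {R : realType} {X : ptopologicalType} {I : countType}.
Context (kappa : X -> X -> \bar R) (Ip : I -> bool) (A : I -> set X).
Context (chi : pmeas R X * pmeas R X) (g : X -> R) (a : I -> R) (c : R).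
Local Open Scope ereal_scope.
Context (hX : hausdorff_space X).
Context (kappa_ge0 : forall x y, 0 <= kappa x y).
Context (kappa_lsc : lower_semicontinuous (fun p : X * X => kappa p.1 p.2)).
Context (kappa_pd : strictly_pd kappa).
Context (A_closed : forall i, closed (A i)).
Context (g_cont : {within Aall A, continuous g}).
Context (c_gt0 : (0 < c)%R) (g_ge : forall x, Aall A x -> (c <= g x)%R).
Context (a_gt0 : forall i, (0 < a i)%R).
Context (a_sum : \esum_(i in [set: I]) (a i)%:E < +oo).
Context (chi1 : finite_energy kappa chi.1) (chi2 : finite_energy kappa chi.2).
Implicit Types mu nu lam : I -> pmeas R X.
Local Notation plate := (plate Ip).
Local Notation mutual := (mutual kappa).

(** Inequalities in place of the constraints, so that solutions of the relaxed and of the full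
    problem, corrections and midpoints all qualify. This alone makes the total mass finite. *)
Definition bounded_by_a mu := forall i, [/\ radon (mu i), mu i (~` A i) = 0 &
  \int[mu i]_(x in A i) (g x)%:E <= (a i)%:E].

Lemma g_cont_on i : {within A i, continuous g}.
Proof. by apply: continuous_subspaceW g_cont => x Ax; exists i. Qed.

Lemma g_ge_on i x : A i x -> (c <= g x)%R.
Proof. by move=> Ax; apply: g_ge; exists i. Qed.

Lemma g_ge0_on i x : A i x -> 0 <= (g x)%:E.
Proof. by move=> /g_ge_on; rewrite lee_fin; apply: le_trans; exact: ltW. Qed.

Lemma measurable_g i :
  measurable_fun (A i : set (borelX X)) (EFin \o g : borelX X -> \bar R).
Proof.
apply: within_continuous_measurable; last exact: g_cont_on.
exact: closed_borel.
Qed.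

Lemma bounded_by_a_mass mu : bounded_by_a mu ->
  (forall i, finite_radon (mu i)) /\ \esum_(i in [set: I]) mu i setT < +oo.
Proof.
move=> bmu; have le i : mu i setT <= c^-1%:E * (a i)%:E.
  have [_ mu0 mua] := bmu i.
  have := mass_le_integral (@A_closed i) mu0 (@g_cont_on i) c_gt0 (@g_ge_on i).
  move=> /le_trans/(_ mua); rewrite muleC -lee_pdivlMr// => /le_trans; apply.
  by rewrite muleC.
split.
  move=> i; have [ri _ _] := bmu i; split => //.
  by apply: (le_lt_trans (le i)); rewrite -EFinM ltry.
apply: (@le_lt_trans _ _ (\esum_(i in [set: I]) (c^-1%:E * (a i)%:E))).
  by apply: le_esum => i _; exact: le.
rewrite esumZl; [|by rewrite invr_ge0 ltW|by move=> i; rewrite lee_fin ltW].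
by rewrite lte_mul_pinfty// lee_fin invr_ge0 ltW.
Qed.

Lemma bounded_by_a_plate s mu : bounded_by_a mu -> finite_radon (plate s mu).
Proof. by move=> /bounded_by_a_mass[rmu mass]; exact: finite_radon_plate. Qed.

(** The positive part of the vector energy dominates the energy of each plate. Conversely, two
    plates of finite energy have finite mutual energy, so both parts are finite. *)
Lemma bounded_by_a_in_EA mu : bounded_by_a mu ->
  in_EA kappa Ip A mu <-> forall s, finite_energy kappa (plate s mu).
Proof.
move=> bmu; have rp s : radon (plate s mu) by case: (bounded_by_a_plate s bmu).
have rmu i : radon (mu i) by case: (bmu i).
have mge0 := mutual_ge0 kappa_ge0.
rewrite /in_EA venergy_posE// venergy_negE//; split=> [[_ pos _] s|fe].
  split; first exact: bounded_by_a_plate.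
  apply: le_lt_trans pos.
  by case: s; [exact: leeDl|exact: leeDr].
split; last 2 first.
- by rewrite lte_add_pinfty//; case: (fe true); case: (fe false).
- by rewrite !energyE// -EFinD ltry.
by move=> i; split => //; apply/(concentrated_closed hX) => //; case: (bmu i).
Qed.

Lemma adm_class_bounded J mu : adm_class kappa Ip A a g J mu ->
  (forall i, ~ J i -> \int[mu i]_(x in A i) (g x)%:E <= (a i)%:E) ->
  bounded_by_a mu.
Proof.
move=> [[vmu _ _] eq] le i; have [ri ci] := vmu i; split => //.
  exact/(concentrated_closed hX).
by have [Ji|/le//] := pselect (J i); rewrite eq.
Qed.

Lemma bounded_by_a_Gchi mu : bounded_by_a mu -> in_EA kappa Ip A mu ->
  Gchi kappa Ip chi mu =
  (gauss kappa chi.1 chi.2 (plate true mu) (plate false mu))%:E.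
Proof.
move=> bmu /(bounded_by_a_in_EA bmu) fe; apply: GchiE => //.
by move=> i; case: (bmu i).
Qed.

Lemma integral_madd (mu nu : pmeas R X) i :
  \int[measure_add mu nu]_(x in A i) (g x)%:E =
  \int[mu]_(x in A i) (g x)%:E + \int[nu]_(x in A i) (g x)%:E.
Proof.
apply: ge0_integral_measure_add.
- exact: closed_borel.
- exact: g_ge0_on.
- exact: measurable_g.
Qed.

Lemma integral_mscale_g (k : {nonneg R}) (mu : pmeas R X) i :
  \int[mscale k mu]_(x in A i) (g x)%:E =
  k%:num%:E * \int[mu]_(x in A i) (g x)%:E.
Proof.
apply: ge0_integral_mscale.
- exact: closed_borel.
- exact: measurable_g.
- exact: g_ge0_on.
Qed.

(** Adding a correction tau to lam restores every constraint. Since L lies in I^-, only the negative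
    plate changes, and [gauss_perturb] bounds the cost. *)
Lemma approximate_solution (L : set I) lam (e : R) :
  (forall l, L l -> inner_cap kappa (A l) = +oo) ->
  (forall l, L l -> Ip l = false) ->
  bounded_by_a lam -> adm_class kappa Ip A a g (~` L) lam -> (0 < e)%R ->
  exists2 mu, adm_class kappa Ip A a g setT mu &
    Gchi kappa Ip chi mu <= Gchi kappa Ip chi lam + e%:E.
Proof.
move=> capL LIp blam [Elam lamE] e0.
have /(bounded_by_a_in_EA blam) flam := Elam.
have rad i : radon (lam i) by case: (blam i).
set u := plate true lam; set v := plate false lam.
pose C := (4 + energy kappa v v + 2 * energy kappa chi.2 chi.2)%R.
have C0 : (0 < C)%R.
  have := energy_ge0 kappa_ge0 v v; have := energy_ge0 kappa_ge0 chi.2 chi.2.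
  by rewrite /C; lra.
(* C is the constant of [gauss_perturb]; this r satisfies both r <= 1 and r C <= e. *)
pose r := (e / (C + e))%R.
have Ce0 : (0 < C + e)%R by rewrite addr_gt0.
have r0 : (0 < r)%R by rewrite divr_gt0.
have r1 : (r <= 1)%R by rewrite ler_pdivrMr// mul1r lerDr ltW.
have rC : (r * C <= e)%R.
  by rewrite mulrAC ler_pdivrMr// ler_pM2l// lerDl ltW.
pose x i := fine (\int[lam i]_(x in A i) (g x)%:E).
have xE i : \int[lam i]_(x in A i) (g x)%:E = (x i)%:E.
  rewrite fineK// ge0_fin_numE; last by apply: integral_ge0 => y; exact: g_ge0_on.
  by have [_ _ le] := blam i; apply: le_lt_trans le _; rewrite ltry.
pose d i := (a i - x i)%R.
have d0 i : (0 <= d i)%R.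
  by rewrite subr_ge0 -lee_fin -xE; case: (blam i).
have dL i : ~ L i -> d i = 0%R.
  by move=> nL; apply/eqP; rewrite subr_eq0 eq_sym -eqe -xE lamE.
have w0 (i : I) : (0 <= 1 / (2 ^ (pickle i).+1)%:R :> R)%R by rewrite divr_ge0.
pose w i : {nonneg R} := NngNum (w0 i).
have delta0 : (0 < r ^+ 2 / 2)%R by rewrite divr_gt0// exprn_gt0.
(* The deficit is multiplied by 2^(n+1), n the code of i, to offset the weight [w i]. Energy r^2/2
   for each sigma^i leaves at most r^2 for a plate. *)
have /choice[sigma sigmaP] : forall i, exists s : pmeas R X,
    [/\ finite_radon s, s (~` A i) = 0,
     \int[s]_(x in A i) (g x)%:E = (d i * (2 ^ (pickle i).+1)%:R)%:E,
     mutual s s <= (r ^+ 2 / 2)%:E & ~ L i -> s = mzero].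
  move=> i; have [Li|nLi] := pselect (L i).
    have di0 : (0 <= d i * (2 ^ (pickle i).+1)%:R)%R by rewrite mulr_ge0.
    have [s [? ? ? ?]] := small_energy hX kappa_ge0 kappa_lsc (capL i Li)
      (@A_closed i) (@g_cont_on i) c_gt0 (@g_ge_on i) di0 delta0.
    by exists s; split.
  exists mzero; split => //.
  - exact: finite_radon_mzero.
  - by rewrite integral_measure_zero dL// mul0r.
  - by rewrite mutual_mzerol lee_fin ltW.
pose tau i : pmeas R X := mscale (w i) (sigma i).
have tauE i : \int[tau i]_(x in A i) (g x)%:E = (d i)%:E.
  have [_ _ sE _ _] := sigmaP i.
  by rewrite integral_mscale_g sE -EFinM /= mulrC mul1r mulfK.
have btau : bounded_by_a tau.
  move=> i; have [rs s0 _ _ _] := sigmaP i; split.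
  - by case: (finite_radon_mscale (w i) hX rs).
  - by rewrite /tau /= /mscale [X in _ * X]s0 mule0.
  - rewrite tauE lee_fin lerBlDr lerDl -lee_fin -xE.
    by apply: integral_ge0 => y; exact: g_ge0_on.
have rT s : finite_radon (plate s tau) by exact: bounded_by_a_plate.
have Tsmall s : mutual (plate s tau) (plate s tau) <= (r ^+ 2)%:E.
  have -> : (r ^+ 2 = 2 * (r ^+ 2 / 2))%R by rewrite mulrC divfK.
  apply: plate_small_energy => //.
  - by move=> i; case: (sigmaP i).
  - exact: ltW.
  - by move=> i; case: (sigmaP i).
  - by case: (rT s).
have fT s : finite_energy kappa (plate s tau).
  by split => //; apply: le_lt_trans (Tsmall s) _; rewrite ltry.
pose mu i : pmeas R X := measure_add (lam i) (tau i).
have muE i : \int[mu i]_(x in A i) (g x)%:E = (a i)%:E.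
  by rewrite integral_madd xE tauE -EFinD /d addrC subrK.
have bmu : bounded_by_a mu.
  move=> i; have [_ l0 _] := blam i; have [_ t0 _] := btau i; split.
  - have [rl _] := bounded_by_a_mass blam; have [rt _] := bounded_by_a_mass btau.
    by case: (finite_radon_add hX (rl i) (rt i)).
  - by rewrite /mu maddE [X in X + _]l0 [X in _ + X]t0 adde0.
  - by rewrite muE.
have plateD s B : plate s mu B = (measure_add (plate s lam) (plate s tau) : pmeas R X) B.
  exact: plate_add.
have Emu : in_EA kappa Ip A mu.
  apply/bounded_by_a_in_EA => // s.
  apply: (finite_energy_eq hX (u := measure_add (plate s lam) (plate s tau))).
    by move=> B _; rewrite plateD.
  exact: finite_energy_add.
exists mu; first by split.
rewrite !bounded_by_a_Gchi// -EFinD lee_fin.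
(* The correction vanishes off L, hence on all of I^+. *)
have uE B : measurable B -> plate true mu B = u B.
  move=> mB; rewrite plateD maddE [X in _ + X]plateE esum1 ?adde0// => i /= Ipi.
  have nL : ~ L i by move=> /LIp; rewrite Ipi.
  have [_ _ _ _ /(_ nL) s0] := sigmaP i.
  by rewrite /tau s0 /= /mscale mule0.
have vE B : measurable B -> plate false mu B = (measure_add v (plate false tau) : pmeas R X) B.
  by move=> _; exact: plateD.
rewrite (gauss_eq kappa _ _ uE vE).
apply: le_trans (gauss_perturb hX kappa_ge0 kappa_lsc kappa_pd chi1 chi2 _ _ _ r0 r1 _) _ => //.
- exact: flam.
- exact: flam.
- by rewrite -lee_fin -energyE.
- by rewrite lerD2l.
Qed.

Lemma Aminus_borel : measurable (Aminus Ip A : set (borelX X)).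
Proof.
rewrite (_ : Aminus Ip A = \bigcup_i (if Ip i then set0 else A i)).
  apply: countable_bigcupT_measurable; first exact: countableP.
  by move=> i; case: ifP => // _; exact: closed_borel.
apply/seteqP; split=> [x [i Ipi Ax]|x [i _]].
  by exists i => //; rewrite (negbTE Ipi).
by case: ifPn => // Ipi Ax; exists i.
Qed.

(** The midpoint determines only R lam. Within I^- the sets A_i may overlap, so the individual
    components cannot be compared, but their sum on A^- can. *)
Lemma minimizers_agree (L : set I) lam lam' :
  (forall i j, Ip i -> ~~ Ip j -> A i `&` A j = set0) ->
  bounded_by_a lam -> bounded_by_a lam' ->
  solves kappa Ip A chi a g (~` L) lam -> solves kappa Ip A chi a g (~` L) lam' ->
  \esum_(i in [set i | Ip i = false]) \int[lam i]_(x in A i) (g x)%:E =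
  \esum_(i in [set i | Ip i = false]) \int[lam' i]_(x in A i) (g x)%:E.
Proof.
move=> disj b1 b2 [[E1 c1] G1] [[E2 c2] G2].
have /(bounded_by_a_in_EA b1) f1 := E1.
have /(bounded_by_a_in_EA b2) f2 := E2.
have h0 : (0 <= 2^-1 :> R)%R by rewrite invr_ge0.
pose k : {nonneg R} := NngNum h0.
pose nu i : pmeas R X := measure_add (lam i) (lam' i).
pose mid i : pmeas R X := mscale k (nu i).
have int_mid i : \int[mid i]_(x in A i) (g x)%:E =
    (2^-1)%:E * (\int[lam i]_(x in A i) (g x)%:E + \int[lam' i]_(x in A i) (g x)%:E).
  by rewrite integral_mscale_g integral_madd.
have bmid : bounded_by_a mid.
  move=> i; have [_ l0 le1] := b1 i; have [_ t0 le2] := b2 i; split.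
  - have [rl _] := bounded_by_a_mass b1; have [rt _] := bounded_by_a_mass b2.
    by case: (finite_radon_mscale k hX (finite_radon_add hX (rl i) (rt i))).
  - rewrite /mid /= /mscale [X in _ * X]maddE [X in X + _]l0 [X in _ + X]t0.
    by rewrite adde0 mule0.
  - rewrite int_mid; apply: (@le_trans _ _ ((2^-1)%:E * ((a i)%:E + (a i)%:E))).
      by rewrite lee_wpmul2l ?lee_fin// leeD.
    by rewrite -EFinD -EFinM lee_fin mulrDr [(_^-1 * _)%R]mulrC -splitr.
have plE s B : plate s mid B =
    (mscale k (measure_add (plate s lam) (plate s lam')) : pmeas R X) B.
  rewrite [LHS]plate_mscale /= /mscale; congr (_ * _).
  exact: plate_add.
have Emid : in_EA kappa Ip A mid.
  apply/bounded_by_a_in_EA => // s.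
  apply: (finite_energy_eq hX (u := mscale k (measure_add (plate s lam) (plate s lam')))).
    by move=> B _; rewrite plE.
  by apply: finite_energy_mscale => //; exact: finite_energy_add.
(* The constraints are affine, so the midpoint is admissible for the relaxed problem. *)
have le_mid : Gchi kappa Ip chi lam <= Gchi kappa Ip chi mid.
  rewrite G1; apply: ereal_inf_lbound; exists mid => //; split => // i Ji.
  by rewrite int_mid c1// c2// -EFinD -EFinM mulrDr [(_^-1 * _)%R]mulrC -splitr.
have eqG : Gchi kappa Ip chi lam' = Gchi kappa Ip chi lam by rewrite G1 G2.
move: le_mid eqG; rewrite !bounded_by_a_Gchi// lee_fin => le_mid [eqG].
rewrite (gauss_eq kappa _ _ (fun B _ => plE true B) (fun B _ => plE false B)) in le_mid.
have PQ := gauss_midpoint hX kappa_ge0 kappa_lsc kappa_pd (erefl : k%:num = 2^-1%R)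
  chi1 chi2 (f1 true) (f1 false) (f2 true) (f2 false) le_mid eqG.
clear le_mid eqG Emid plE bmid int_mid.
have mAm := Aminus_borel.
(* The positive plate has no mass on A^-, because each A_i with i in I^+ is disjoint from it; there
   R lam reduces to minus the negative plate. *)
have null mu (B : set (borelX X)) : bounded_by_a mu -> measurable B ->
    B `<=` Aminus Ip A -> plate true mu B = 0.
  move=> bmu mB BA; rewrite plateE esum1// => i /= Ipi.
  have [_ mu0 _] := bmu i; apply/eqP; rewrite eq_le measure_ge0 andbT -mu0.
  apply: le_measure; rewrite ?inE//.
    by apply: measurableC; exact: closed_borel.
  move=> y /BA[j Ipj Ajy] Aiy.
  by have : (A i `&` A j) y by []; rewrite disj// Ipi.
have eq_minus (B : set (borelX X)) : measurable B -> B `<=` Aminus Ip A ->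
    plate false lam B = plate false lam' B.
  move=> mB BA; have := PQ B mB; rewrite !measure_addE.
  by rewrite [X in X + _]null// [X in _ = X + _]null// !add0e.
clear PQ.
have g0 y : Aminus Ip A y -> 0 <= (g y)%:E.
  by case=> i _; exact: g_ge0_on.
have mg : measurable_fun (Aminus Ip A : set (borelX X)) (EFin \o g : borelX X -> \bar R).
  apply: within_continuous_measurable => //.
  by apply: continuous_subspaceW g_cont => y [i _ Ay]; exists i.
(* Each component over I^- lives on its own A_i inside A^-, so its integral may be taken over A^-
   and the sum becomes one integral against the plate. *)
have sumE mu : bounded_by_a mu ->
    \esum_(i in [set i | Ip i = false]) \int[mu i]_(x in A i) (g x)%:E =
    \int[plate false mu]_(x in Aminus Ip A) (g x)%:E.
  move=> bmu; rewrite plate_integral//; apply: eq_esum => i /= Ipi.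
  apply/esym; apply: integral_concentrated => //.
  - exact: closed_borel.
  - by move=> y Ay; exists i => //; rewrite Ipi.
  - by case: (bmu i).
rewrite !sumE//; apply: eq_measure_integral => B mB BA; exact: eq_minus.
Qed.

End GaussProblem.

Theorem theorem7p2 (R : realType) (X : ptopologicalType)
  (kappa : X -> X -> \bar R) (h : R)
  (I : countType) (Ip : I -> bool) (A : I -> set X)
  (chi : {measure set (borelX X) -> \bar R} * {measure set (borelX X) -> \bar R})
  (g : X -> R) (a : I -> R) :
  (* X noncompact locally compact Hausdorff *)
  hausdorff_space X -> locally_compact [set: X] -> ~ compact [set: X] ->
  (* kernel: [0,oo]-valued, lsc, symmetric, (a)-(e) *)
  (forall x y, (0 <= kappa x y)%E) ->
  lower_semicontinuous (fun p : X * X => kappa p.1 p.2) ->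
  (forall x y, kappa x y = kappa y x) ->
  strictly_pd kappa -> consistent kappa -> offdiag_continuous kappa ->
  kernel_decay kappa -> 1 <= h -> gen_max_principle kappa h ->
  (* condenser, external field, g, a *)
  condenser kappa Ip A -> external_field kappa Ip A chi -> g_admissible kappa A g ->
  (forall i, 0 < a i) -> (\esum_(i in [set: I]) (a i)%:E < +oo)%E ->
  (Ginf kappa Ip A chi a g [set: I] < +oo)%E ->
  let L := [set l | inner_cap kappa (A l) = +oo%E] in
  L !=set0 -> (forall l, L l -> ~~ Ip l) ->
  forall lam : I -> {measure set (borelX X) -> \bar R},
  solves kappa Ip A chi a g (~` L) lam ->
  (forall l, L l -> (\int[lam l]_(x in A l) (g x)%:E <= (a l)%:E)%E) ->
  Ginf kappa Ip A chi a g [set: I] = Ginf kappa Ip A chi a g (~` L) /\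
  ((exists lam' : I -> {measure set (borelX X) -> \bar R},
       solves kappa Ip A chi a g [set: I] lam') <->
   (forall l, L l -> (\int[lam l]_(x in A l) (g x)%:E)%E = (a l)%:E)).
Proof.
move=> hX _ _ k0 klsc _ kpd _ _ _ _ _ [Acl _ disj _].
move=> [[[rchi1 rchi2 _] echi _] mchi1 mchi2 _ _] [gc [c [c0 cg]] _] a0 asum _ L _ LIp.
move=> lam slam lamL; have [clam Glam] := slam.
have clA i : closed (A i) by case: (Acl i).
have mge0 := mutual_ge0 k0.
have f1 : finite_energy kappa chi.1.
  split => //; apply: le_lt_trans echi; exact: leeDl.
have f2 : finite_energy kappa chi.2.
  split => //; apply: le_lt_trans echi; exact: leeDr.
have blam : bounded_by_a A g a lam.
  by apply: (adm_class_bounded hX clA clam) => i /contrapT; exact: lamL.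
have LIp' l : L l -> Ip l = false by move=> /LIp/negbTE.
have sub mu : adm_class kappa Ip A a g setT mu -> adm_class kappa Ip A a g (~` L) mu.
  by case=> Emu eq; split => // i _; exact: eq.
have Geq : Ginf kappa Ip A chi a g [set: I] = Ginf kappa Ip A chi a g (~` L).
  (* Dropping constraints can only lower the infimum; the other inequality holds up to every e > 0
     by correcting lam. *)
  apply/eqP; rewrite eq_le; apply/andP; split; last first.
    by apply: le_ereal_inf => _ [mu /sub cmu <-]; exists mu.
  rewrite -Glam; apply/lee_addgt0Pr => e e0.
  have [mu cmu le_mu] := @approximate_solution _ _ _ _ Ip _ chi _ _ _ hX k0 klsc kpd
    clA gc c0 cg a0 asum f1 f2 L lam e (fun l Ll => Ll) LIp' blam clam e0.
  by apply: le_trans le_mu; apply: ereal_inf_lbound; exists mu.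
split => //; split=> [[lam' [clam' Glam']] l Ll|lamE].
  have blam' : bounded_by_a A g a lam'.
    by apply: (adm_class_bounded hX clA clam') => i /(_ Logic.I).
  (* As the infima coincide, a solution of the full problem also minimizes the relaxed one. *)
  have slam' : solves kappa Ip A chi a g (~` L) lam'.
    by split; [exact: sub|rewrite Glam'].
  have := minimizers_agree hX k0 klsc kpd clA gc c0 cg a0 asum f1 f2
    disj blam blam' slam slam'.
  have -> : (\esum_(i in [set i | Ip i = false]) \int[lam' i]_(x in A i) (g x)%:E =
      \esum_(i in [set i | Ip i = false]) (a i)%:E)%E.
    by apply: eq_esum => i _; case: clam' => _; apply.
  (* The two sums over I^- are equal and finite and the terms are ordered, so the terms agree, in
     particular at l in L. *)
  move=> /esum_le_eq; apply.
  - move=> i _; have [_ _ ->] := blam i; rewrite andbT.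
    by apply: integral_ge0 => y Ay; exact: (g_ge0_on c0 cg Ay).
  - apply: le_lt_trans asum; rewrite esum_mkcond; apply: le_esum => i _.
    by case: ifP => // _; rewrite lee_fin ltW.
  - exact: LIp'.
(* With equality on L, lam itself is admissible for the full problem and attains the common
   infimum. *)
exists lam; split; last by rewrite Geq.
case: clam => Elam lamE'; split => // i _.
by have [/lamE|/lamE'] := pselect (L i).
Qed.
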